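(* Let $h\in\mathbb N_0$. The symplectic spinors of homogeneity $h$ in the variables $x,y$, odd in the variable $q$, given for $k\in\mathbb N_0$ with $k\ge h$ by $$\tilde s_{o,k}^h=e^{-\frac{q^2}{2}}\sum_{p=0}^h(-1)^p\frac{(2k+1)!!}{(2k-2p+1)!!}\binom hp q^{2k+1-2p}(x+\mathrm{i}y)^{h-p}(\mathrm{i}y)^p,$$ form a (topological) basis of the odd part of $M_h^s$; and the symplectic spinors of homogeneity $h$, even in the variable $q$, given for $k\in\mathbb N_0$ by $$\tilde s_{e,k}^h=e^{-\frac{q^2}{2}}\sum_{p=0}^h(-1)^p\frac{(2k)!!}{(2k-2p)!!}\binom hp q^{2k-2p}(x+\mathrm{i}y)^{h-p}(\mathrm{i}y)^p,$$ form a (topological) basis of the even part of $M_h^s$.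
   Context: Here $(x,y)\in\mathbb R^2$, $q\in\mathbb R$, $\mathcal S(\mathbb R)$ is the Schwartz space in $q$, $\mathrm{Pol}_h(\mathbb R^2,\mathbb C)$ the homogeneous polynomials of degree $h$ in $x,y$, $D_s=\mathrm{i}q\partial_y-\partial_x\partial_q$ the symplectic Dirac operator, and $M_h^s=(\mathrm{Pol}_h(\mathbb R^2,\mathbb C)\otimes\mathcal S(\mathbb R))\cap\mathrm{Ker}(D_s)$ the symplectic monogenics of homogeneity $h$; its odd (even) part consists of the elements that are odd (even) functions of $q$. ''(Topological) basis'' is meant in the sense in which $\{q^je^{-q^2/2}\}_{j\in\mathbb N_0}$ is a (topological) basis of $\mathcal S(\mathbb R)$: linearly independent with dense linear span, where $\mathrm{Pol}_h(\mathbb R^2,\mathbb C)\otimes\mathcal S(\mathbb R)\cong\mathcal S(\mathbb R)^{h+1}$ carries the Fréchet topology. Double factorials: $(2m)!!=2\cdot4\cdots(2m)$, $0!!=1$, $(2m+1)!!=1\cdot3\cdots(2m+1)$; in $\tilde s_{e,k}^h$ the terms with $p>k$ are zero (convention $1/(2k-2p)!!=0$ for $p>k$). *)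

(* Defs.v *)
From HB Require Import structures.
From mathcomp Require Import all_boot all_order all_algebra.
From mathcomp Require Import all_classical all_reals all_analysis.
From mathcomp Require Export complex.

Set Implicit Arguments.
Unset Strict Implicit.
Unset Printing Implicit Defensive.

Import Order.TTheory GRing.Theory Num.Theory.
Import numFieldNormedType.Exports.
Import Normc.

Local Open Scope classical_set_scope.
Local Open Scope ring_scope.
Local Open Scope complex_scope.

(* [R[i]] carries no normed-module structure over [R] in the library, so the
   derivative of a complex-valued function of a real variable is taken on the
   real and imaginary parts. *)
Definition cderive (R : realType) (f : R -> R[i]) (t : R) : R[i] :=
  derive1 (fun s => complex.Re (f s)) t +i* derive1 (fun s => complex.Im (f s)) t.

Definition cderiven (R : realType) (n : nat) (f : R -> R[i]) : R -> R[i] :=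
  iter n (@cderive R) f.

Definition csmooth (R : realType) (f : R -> R[i]) : Prop :=
  forall (n : nat) (t : R),
    derivable (fun s => complex.Re (cderiven n f s)) t 1 /\
    derivable (fun s => complex.Im (cderiven n f s)) t 1.

Definition weighted (R : realType) (a b : nat) (f : R -> R[i]) (q : R) : R :=
  `|q| ^+ a * normc (cderiven b f q).

Definition is_schwartz (R : realType) (f : R -> R[i]) : Prop :=
  csmooth f /\ forall a b : nat, has_ubound (range (weighted a b f)).

Definition seminorm (R : realType) (a b : nat) (f : R -> R[i]) : R :=
  sup (range (weighted a b f)).

Record schwartz (R : realType) := Schwartz {
  schwartz_fun :> R -> R[i];
  schwartzP : is_schwartz schwartz_fun }.

HB.instance Definition _ (R : realType) := gen_eqMixin (schwartz R).
HB.instance Definition _ (R : realType) := gen_choiceMixin (schwartz R).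

(* The Frechet topology of S(R): the uniformity whose basic entourages are
   p_{a,b}(f - g) < e for all a, b <= N, with p_{a,b} the [seminorm]s. *)
Definition schwartz_close (R : realType) (N : nat) (e : R) :
    set (schwartz R * schwartz R) :=
  [set fg : schwartz R * schwartz R | forall a b : nat, (a <= N)%N -> (b <= N)%N ->
     seminorm a b (fun q => fg.1 q - fg.2 q) < e].

Definition schwartz_entourage (R : realType) :
    set_system (schwartz R * schwartz R) :=
  filter_from [set Ne : nat * R | 0 < Ne.2]
    (fun Ne => schwartz_close Ne.1 Ne.2).

Lemma cderivenB (R : realType) (n : nat) (f g : R -> R[i]) :
  csmooth f -> csmooth g ->
  cderiven n (fun q => f q - g q) = fun q => cderiven n f q - cderiven n g q.
Proof.
move=> sf sg; elim: n => // n IHn.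
rewrite {1}/cderiven iterS -/(cderiven _ _) IHn; apply/funext => t.
have [df1 df2] := sf n t; have [dg1 dg2] := sg n t.
rewrite /cderiven !iterS -!/(cderiven _ _) /cderive.
have -> : (fun s => complex.Re (cderiven n f s - cderiven n g s)) =
  (fun s => complex.Re (cderiven n f s)) - (fun s => complex.Re (cderiven n g s)).
  by apply/funext => s /=; rewrite raddfB.
have -> : (fun s => complex.Im (cderiven n f s - cderiven n g s)) =
  (fun s => complex.Im (cderiven n f s)) - (fun s => complex.Im (cderiven n g s)).
  by apply/funext => s /=; rewrite raddfB.
have eB (u v : R -> R) : derivable u t 1 -> derivable v t 1 ->
    derive1 (u - v) t = derive1 u t - derive1 v t.
  by move=> du dv; rewrite !derive1E deriveB.
by rewrite (eB _ _ df1 dg1) (eB _ _ df2 dg2).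
Qed.

Lemma cderivenN (R : realType) (n : nat) (f g : R -> R[i]) :
  csmooth f -> csmooth g -> forall q,
  normc (cderiven n (fun q => f q - g q) q) =
  normc (cderiven n (fun q => g q - f q) q).
Proof.
by move=> sf sg q; rewrite !cderivenB// -(opprB (cderiven n f q)) normcN.
Qed.

Lemma weighted_triangle (R : realType) (a b : nat) (f g k : schwartz R) (q : R) :
  weighted a b (fun q => f q - g q) q <=
  weighted a b (fun q => f q - k q) q + weighted a b (fun q => k q - g q) q.
Proof.
have [sf _] := schwartzP f; have [sg _] := schwartzP g; have [sk _] := schwartzP k.
rewrite /weighted !cderivenB// -mulrDr ler_wpM2l ?exprn_ge0//.
by rewrite -(subrKA (cderiven b k q)) le_normcD.
Qed.

Lemma weighted_ubound (R : realType) (a b : nat) (f g : schwartz R) :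
  has_ubound (range (weighted a b (fun q => f q - g q))).
Proof.
have [sf bf] := schwartzP f; have [sg bg] := schwartzP g.
have [M uM] := bf a b; have [N uN] := bg a b.
exists (M + N) => _ [q _ <-]; rewrite /weighted cderivenB//.
apply: (@le_trans _ _ (weighted a b f q + weighted a b g q)); last first.
  by rewrite lerD//; [apply: uM|apply: uN]; exists q.
rewrite /weighted -mulrDr ler_wpM2l ?exprn_ge0//.
by apply: le_trans (le_normcD _ _) _; rewrite normcN.
Qed.

Lemma seminorm_triangle (R : realType) (a b : nat) (f g k : schwartz R) :
  seminorm a b (fun q => f q - g q) <=
  seminorm a b (fun q => f q - k q) + seminorm a b (fun q => k q - g q).
Proof.
apply: ge_sup; first by exists (weighted a b (fun q => f q - g q) 0), 0.
move=> _ [q _ <-]; apply: le_trans (weighted_triangle a b f g k q) _.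
by apply: lerD; apply: ub_le_sup; (exact: weighted_ubound) || exists q.
Qed.

Lemma seminorm_sym (R : realType) (a b : nat) (f g : schwartz R) :
  seminorm a b (fun q => f q - g q) = seminorm a b (fun q => g q - f q).
Proof.
have [sf _] := schwartzP f; have [sg _] := schwartzP g.
rewrite /seminorm; congr (sup (image _ _)).
by apply/funext => q; rewrite /weighted cderivenN.
Qed.

Lemma seminorm_refl (R : realType) (a b : nat) (f : schwartz R) :
  seminorm a b (fun q => f q - f q) = 0.
Proof.
have [sf _] := schwartzP f; rewrite /seminorm.
suff -> : range (weighted a b (fun q => f q - f q)) = [set 0] by rewrite sup1.
have w0 q : weighted a b (fun q => f q - f q) q = 0.
  by rewrite /weighted cderivenB// subrr normc0 mulr0.
by apply/seteqP; split=> [_ [q _ <-]|_ ->] /=; [|exists 0].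
Qed.

Lemma schwartz_entourage_filter (R : realType) : Filter (@schwartz_entourage R).
Proof.
apply: filter_from_filter; first by exists (0%N, 1); rewrite /= ltr01.
move=> [N d] [M e] /= d0 e0; exists (maxn N M, Num.min d e) => /=.
  by rewrite lt_min d0.
move=> fg H; split=> a b /= ha hb;
  have := H a b; rewrite !leq_max ha hb ?orbT => /(_ isT isT);
  by rewrite lt_min => /andP[].
Qed.

Lemma schwartz_entourage_diagonal (R : realType)
    (A : set (schwartz R * schwartz R)) :
  schwartz_entourage A -> diagonal `<=` A.
Proof.
move=> [[N e] /= e0 sA] [f g]; rewrite /diagonal /= => ->; apply: sA => a b _ _ /=.
by rewrite seminorm_refl.
Qed.

Lemma schwartz_entourage_inv (R : realType)
    (A : set (schwartz R * schwartz R)) :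
  schwartz_entourage A -> schwartz_entourage A^-1%relation.
Proof.
move=> [[N e] /= e0 sA]; exists (N, e) => // -[f g] H.
by apply: sA => a b ha hb /=; rewrite seminorm_sym; apply: H.
Qed.

Lemma schwartz_entourage_split (R : realType)
    (A : set (schwartz R * schwartz R)) :
  schwartz_entourage A ->
  exists2 B, schwartz_entourage B & (B \; B `<=` A)%relation.
Proof.
move=> [[N e] /= e0 sA]; exists (schwartz_close N (e / 2)).
  by exists (N, e / 2) => //=; rewrite divr_gt0.
move=> [f g] [k /= fk kg]; apply: sA => a b ha hb /=.
apply: le_lt_trans (seminorm_triangle a b f g k) _.
by rewrite [e]splitr ltrD//; [apply: fk|apply: kg].
Qed.

HB.instance Definition _ (R : realType) := isUniform.Build (schwartz R)
  (@schwartz_entourage_filter R) (@schwartz_entourage_diagonal R)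
  (@schwartz_entourage_inv R) (@schwartz_entourage_split R).

(* Functions of (x, y, q), in this order. *)
Definition spinor (R : realType) := R -> R -> R -> R[i].

(* S(R)^{h+1} with the product topology. *)
Definition spinor_coef (R : realType) (h : nat) :=
  {ptws 'I_h.+1 -> schwartz R}.

(* The identification of S(R)^{h+1} with Pol_h (x) S(R), the latter seen as a
   space of functions of (x, y, q): the coordinate [f j] is the coefficient of
   x^(h-j) y^j. *)
Definition spinor_of (R : realType) (h : nat) (f : spinor_coef R h) : spinor R :=
  fun x y q => \sum_(j < h.+1) (x ^+ (h - j) * y ^+ j)%:C * f j q.

Definition polS (R : realType) (h : nat) : set (spinor R) :=
  range (@spinor_of R h).

Definition polS_closure (R : realType) (h : nat) (A : set (spinor R)) :
    set (spinor R) :=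
  @spinor_of R h @` closure (@spinor_of R h @^-1` A).

Definition d_x (R : realType) (u : spinor R) : spinor R :=
  fun x y q => cderive (fun t => u t y q) x.
Definition d_y (R : realType) (u : spinor R) : spinor R :=
  fun x y q => cderive (fun t => u x t q) y.
Definition d_q (R : realType) (u : spinor R) : spinor R :=
  fun x y q => cderive (fun t => u x y t) q.

(* ['i%C] is the pair (0, 1), not the abstractly chosen root [Num.imaginary]. *)
Definition Ds (R : realType) (u : spinor R) : spinor R :=
  fun x y q => 'i%C * q%:C * d_y u x y q - d_x (d_q u) x y q.

Definition monogenic (R : realType) (h : nat) : set (spinor R) :=
  [set u | polS h u /\ forall x y q, Ds u x y q = 0].

Definition monogenic_odd (R : realType) (h : nat) : set (spinor R) :=
  [set u | monogenic h u /\ forall x y q, u x y (- q) = - u x y q].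

Definition monogenic_even (R : realType) (h : nat) : set (spinor R) :=
  [set u | monogenic h u /\ forall x y q, u x y (- q) = u x y q].

Definition lincomb (R : realType) (I : pred nat) (s : nat -> spinor R)
    (n : nat) (c : nat -> R[i]) : spinor R :=
  fun x y q => \sum_(k < n | I k) c k * s k x y q.

Definition cspan (R : realType) (I : pred nat) (s : nat -> spinor R) :
    set (spinor R) :=
  [set u | exists n c, u = lincomb I s n c].

Definition lin_indep (R : realType) (I : pred nat) (s : nat -> spinor R) : Prop :=
  forall (n : nat) (c : nat -> R[i]),
    (forall x y q, lincomb I s n c x y q = 0) ->
    forall k, (k < n)%N -> I k -> c k = 0.

(* Here [M] is a linear subspace of Pol_h (x) S(R): the first clause puts the
   span inside [M], so the last one says that the span is dense in [M]. *)
Definition topological_basis (R : realType) (h : nat) (M : set (spinor R))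
    (I : pred nat) (s : nat -> spinor R) : Prop :=
  [/\ forall k, I k -> M (s k),
      lin_indep I s
    & M `<=` polS_closure h (cspan I s)].

Fixpoint double_fact (n : nat) : nat :=
  match n with
  | m.+2 => (n * double_fact m)%N
  | _ => 1%N
  end.

(* For p <= h <= k the truncated subtraction 2k+1-2p is exact; this family is
   only used for k >= h. *)
Definition s_odd (R : realType) (h k : nat) : spinor R := fun x y q =>
  (expR (- (q ^+ 2 / 2)))%:C *
  \sum_(p < h.+1)
    (-1) ^+ p
    * ((double_fact (2 * k + 1)%N)%:R / (double_fact (2 * k + 1 - 2 * p)%N)%:R)
    * 'C(h, p)%:R * q%:C ^+ (2 * k + 1 - 2 * p)
    * (x%:C + 'i%C * y%:C) ^+ (h - p) * ('i%C * y%:C) ^+ p.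

(* The terms with p > k vanish by the convention 1/(2k-2p)!! = 0. *)
Definition s_even (R : realType) (h k : nat) : spinor R := fun x y q =>
  (expR (- (q ^+ 2 / 2)))%:C *
  \sum_(p < h.+1 | (p <= k)%N)
    (-1) ^+ p
    * ((double_fact (2 * k)%N)%:R / (double_fact (2 * k - 2 * p)%N)%:R)
    * 'C(h, p)%:R * q%:C ^+ (2 * k - 2 * p)
    * (x%:C + 'i%C * y%:C) ^+ (h - p) * ('i%C * y%:C) ^+ p.

(* Main.v *)
Require Import Defs.
From mathcomp Require Import all_boot all_order all_algebra.
From mathcomp Require Import all_classical all_reals all_analysis.
From mathcomp Require Import ring lra zify.

(* Write u = sum_j x^(h-j) y^j f_j(q) and L = q^-1 d/dq = d/dt, where t = q^2/2.
   Then u is monogenic iff f_j = C(h,j) (-i)^j L^j f_0 for all j, so u is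
   determined by f_0.  If u is even then f_0 is an even Schwartz function; if u
   is odd, the divisibilities by q force f_0 = q^(2h+1) g with g even Schwartz.
   Since L (e^-t P) = e^-t (P' - P), the binomial theorem identifies the s_k as
   the spinors with f_0 = q^(2k) e^-t (resp. q^(2k+1) e^-t), and everything
   reduces to approximating an even Schwartz function g by e^-t P(t), in the
   sense that L^j (g - e^-t P) is small with polynomial weights for all j <= n.
   A function vanishing at infinity is recovered from L of it by integration from
   infinity, which does not lose more than the weight gained, and P |-> P' - P is
   onto; so it suffices to approximate L^n g in a weighted sup norm.  This is
   Weierstrass' theorem in the variable w = e^(-t/4), followed by the Taylor
   expansion of the powers of w. *)
Set Implicit Arguments.
Unset Strict Implicit.
Unset Printing Implicit Defensive.

Import Order.TTheory GRing.Theory Num.Theory.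
Import numFieldNormedType.Exports.
Import Normc.

Local Open Scope classical_set_scope.
Local Open Scope ring_scope.
Local Open Scope complex_scope.

(** Density is delicate because the coefficients are coupled: approximating f_0 alone says nothing
    about L^j f_0, and in the odd case L^j of a nearby odd Gaussian polynomial is in general
    singular at q = 0. The factor q^(2h+1) is therefore split off before approximating g and
    restored afterwards by the Leibniz rule for the derivation L. The even and odd cases become one
    statement with an exponent m, 0 or 2h+1, under the condition that L is never applied to q^1,
    where it would leave the polynomials. Schwartz seminorms need no separate estimate of
    derivatives: d/dq = q L rewrites each q-derivative as a finite sum of terms c q^r L^j, so
    finitely many weighted bounds on the L^j control a given seminorm. To avoid dividing by q, the
    iterates L^n are encoded as a sequence D with D_n' = q D_(n+1); identities obtained by
    cancelling q hold off 0 and pass to 0 by continuity. *)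

Section RealDerivatives.
Context {R : realType}.
Implicit Types (f g : R -> R) (x a b k : R).

Lemma der_eq f x a b : is_derive x 1 f a -> a = b -> is_derive x 1 f b.
Proof. by move=> df <-. Qed.

Lemma derD f g x a b : is_derive x 1 f a -> is_derive x 1 g b ->
  is_derive x 1 (fun t => f t + g t) (a + b).
Proof. by move=> df dg; exact: is_deriveD. Qed.

Lemma derB f g x a b : is_derive x 1 f a -> is_derive x 1 g b ->
  is_derive x 1 (fun t => f t - g t) (a - b).
Proof. by move=> df dg; exact: is_deriveB. Qed.

Lemma derN f x a : is_derive x 1 f a -> is_derive x 1 (fun t => - f t) (- a).
Proof. by move=> df; exact: is_deriveN. Qed.

Lemma derM f g x a b : is_derive x 1 f a -> is_derive x 1 g b ->
  is_derive x 1 (fun t => f t * g t) (a * g x + f x * b).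
Proof.
move=> df dg; apply: (@is_derive_eq _ _ _ (f * g)).
by rewrite /GRing.scale/= addrC [g x * a]mulrC.
Qed.

Lemma derZ k f x a : is_derive x 1 f a -> is_derive x 1 (fun t => k * f t) (k * a).
Proof. by move=> df; exact: is_deriveZ. Qed.

Lemma derX n x : is_derive x 1 (fun t : R => t ^+ n) (n%:R * x ^+ n.-1).
Proof.
have -> : (fun t : R => t ^+ n) = horner 'X^n by apply/funext => t; rewrite hornerXn.
by apply: der_eq; rewrite derivXn hornerMn hornerXn mulr_natl.
Qed.

Lemma der_comp f g x a b : is_derive (g x) 1 f a -> is_derive x 1 g b ->
  is_derive x 1 (fun t => f (g t)) (a * b).
Proof. by move=> df dg; exact: is_derive1_comp. Qed.

Lemma der_expR g x b : is_derive x 1 g b ->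
  is_derive x 1 (fun t => expR (g t)) (expR (g x) * b).
Proof. by move=> dg; exact: (der_comp (is_derive_expR _) dg). Qed.

Lemma der_derive1 f x a : is_derive x 1 f a -> derive1 f x = a.
Proof. by move=> df; rewrite derive1E; exact: derive_val. Qed.

Lemma derivable_der f x : derivable f x 1 -> is_derive x 1 f (derive1 f x).
Proof. by move=> df; rewrite derive1E; exact: derivableP. Qed.

Lemma der_continuous f x a : is_derive x 1 f a -> {for x, continuous f}.
Proof. by move=> df; apply/differentiable_continuous/derivable1_diffP. Qed.

Lemma der_nondecreasing f (df : R -> R) a b :
  (forall x, is_derive x 1 f (df x)) -> (forall x, a < x < b -> 0 <= df x) ->
  a <= b -> f a <= f b.
Proof.
move=> fd df0 ab; apply: (@ger0_derive1_ndecr _ f a b) => //.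
- by move=> x; rewrite in_itv/= => xab; rewrite (der_derive1 (fd x)) df0.
- by apply: continuous_subspaceT => x; exact: (der_continuous (fd x)).
Qed.

End RealDerivatives.

(** * Bernstein polynomials *)

Definition lsum (K : comNzRingType) (n : nat) (V : nat -> nat -> K) : K :=
  \sum_(j < n.+1) 'C(n, j)%:R * V (n - j)%N j.

(** Pascal's rule. The summand keeps both indices, so that one recursion serves the Bernstein sums
    [bsum] and the Leibniz rule [leibniz]. *)
Lemma lsumS (K : comNzRingType) n (V : nat -> nat -> K) :
  lsum n.+1 V = lsum n (fun i j => V i.+1 j) + lsum n (fun i j => V i j.+1).
Proof.
rewrite /lsum big_ord_recl /= bin0 subn0.
under eq_bigr => i _ do rewrite /bump/= add1n subSS binS natrD !mulrDl.
rewrite big_split/= addrA; congr (_ + _).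
rewrite [in RHS]big_ord_recl /= bin0 subn0; congr (_ + _).
rewrite [LHS]big_ord_recr/= bin_small// !mul0r addr0.
by apply: eq_bigr => i _; rewrite /bump/= add1n -(subnSK (ltn_ord i)).
Qed.

Definition bsum (K : comNzRingType) (n : nat) (a b : K) (V : nat -> K) : K :=
  lsum n (fun i j => a ^+ i * b ^+ j * V j).

Lemma bsumS (K : comNzRingType) n (a b : K) V :
  bsum n.+1 a b V = a * bsum n a b V + b * bsum n a b (fun j => V j.+1).
Proof.
rewrite /bsum lsumS /lsum !mulr_sumr; congr (_ + _); apply: eq_bigr => j _;
  rewrite exprS; ring.
Qed.

Lemma bsum0 (K : comNzRingType) (a b : K) V : bsum 0 a b V = V 0%N.
Proof. by rewrite /bsum /lsum big_ord1/= bin0 !expr0 !mul1r. Qed.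

Lemma bsum_const (K : comNzRingType) n (a b : K) : a + b = 1 ->
  bsum n a b (fun _ => 1) = 1.
Proof.
by move=> ab1; elim: n => [|n IH]; rewrite ?bsum0// bsumS IH !mulr1.
Qed.

(** For c = n w this is the variance of the binomial law. The free centre c carries the induction:
    shifting k by one replaces c by c - 1. *)
Lemma bsum_variance (K : comNzRingType) n (w c : K) :
  bsum n (1 - w) w (fun k => (k%:R - c) ^+ 2) =
  n%:R * w * (1 - w) + (n%:R * w - c) ^+ 2.
Proof.
elim: n c => [|n IH] c; first by rewrite bsum0; ring.
rewrite bsumS IH.
rewrite (_ : (fun j : nat => _) = fun j : nat => (j%:R - (c - 1)) ^+ 2 :> K).
  by rewrite IH -!natr1; ring.
by apply/funext => j; rewrite -natr1; ring.
Qed.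

(** * Weierstrass approximation on the unit interval *)

Section Weierstrass.
Context {R : realType}.


Lemma uniform_continuity_itv01 (f : R -> R) (e : R) : continuous f -> 0 < e ->
  exists2 d : R, 0 < d & forall x y : R, 0 <= x <= 1 -> `|x - y| < d -> `|f x - f y| < e.
Proof.
move=> fc e0.
have /compact_near_coveringP/(_ R (0 : R)^'+
    (fun d x => forall y, `|x - y| < d -> `|f x - f y| < e)) := @segment_compact R 0 1.
case=> [|d /= d0 Hd].
  move=> x _; have /cvgrPdist_lt/(_ _ (divr_gt0 e0 (ltr0n R 2))) := fc x.
  case=> r /= r0 Hr.
  (* Half the radius, so that x' and every y within d of x' both stay within r of x. *)
  exists (ball x (r / 2), [set d | 0 < d < r / 2]) => /=.
    split; first by apply: nbhsx_ballx; rewrite divr_gt0.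
    by exists (r / 2) => /=; [rewrite divr_gt0|move=> d /=; rewrite sub0r normrN => +
       d0; rewrite gtr0_norm// d0].
  move=> [x' d] /= [xx' /andP[d0 dr]] y x'y.
  rewrite [e]splitr (le_lt_trans (ler_distD (f x) _ _))// ltrD//.
    by rewrite distrC; apply: Hr; apply: lt_trans xx' _; rewrite ltr_pdivrMr// ltr_pMr// ltrDl.
  apply: Hr => /=; rewrite [r]splitr (le_lt_trans (ler_distD x' _ _))// ltrD//.
  exact: lt_trans x'y dr.
exists (d / 2); first by rewrite divr_gt0.
move=> x y x01; apply: (Hd (d / 2)) => //=; last by rewrite divr_gt0.
by rewrite sub0r normrN gtr0_norm ?divr_gt0// ltr_pdivrMr// ltr_pMr// ltrDl.
Qed.

(** Bernstein's proof. Uniform continuity for near points and the bound 2M for far ones combine into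
    |f x - f y| <= e/2 + C (y - x)^2 with C = 2M/d^2. Averaging over the binomial weights, the
    square becomes a variance, which contributes at most C/n <= e/2. *)
Theorem weierstrass_itv01 (f : R -> R) (e : R) : continuous f -> 0 < e ->
  exists p : {poly R}, forall w : R, 0 <= w <= 1 -> `|f w - p.[w]| <= e.
Proof.
move=> fc e0.
have e20 : 0 < e / 2 by rewrite divr_gt0.
have [d d0 fd] := uniform_continuity_itv01 fc e20.
have [M M0 fM] : exists2 M : R, 0 < M & forall x : R, 0 <= x <= 1 -> `|f x| <= M.
  have fw : {within `[0, 1], continuous (fun x => `|f x|)}.
    apply: continuous_subspaceT => x; apply: continuous_comp; first exact: fc.
    exact: norm_continuous.
  have [c _ fmax] := EVT_max ler01 fw.
  exists (`|f c| + 1); first by rewrite ltr_wpDl.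
  by move=> x x01; rewrite (le_trans (fmax x _)) ?lerDl// in_itv.
pose C := 2 * M / d ^+ 2.
have C0 : 0 < C by rewrite divr_gt0 ?mulr_gt0// exprn_gt0.
have fC (x y : R) : 0 <= x <= 1 -> 0 <= y <= 1 ->
    `|f x - f y| <= e / 2 + C * (y - x) ^+ 2.
  move=> x01 y01; have [xyd|dxy] := ltP `|x - y| d.
    by rewrite (le_trans (ltW (fd _ _ x01 xyd)))// lerDl mulr_ge0 ?sqr_ge0// ltW.
  rewrite (@le_trans _ _ (2 * M))//.
    by rewrite (le_trans (ler_normB _ _))// mulrDl mul1r lerD// fM.
  rewrite (@le_trans _ _ (C * (y - x) ^+ 2))//; last by rewrite lerDr ltW.
  rewrite /C mulrAC -[leRHS]mulrA ler_peMr ?mulr_ge0 ?(ltW M0)// ler_pdivlMr ?exprn_gt0// mul1r.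
  by rewrite -[leRHS]real_normK ?num_real// distrC ler_pXn2r ?nnegrE ?(ltW d0).
pose N := Num.bound (C / (e / 2)).
have CN : C <= e / 2 * N.+1%:R.
  rewrite mulrC -ler_pdivrMr//; apply: ltW.
  by rewrite (lt_le_trans (archi_boundP _)) ?ler_nat// divr_ge0// ltW.
pose n := N.+1; have n0 : 0 < n%:R :> R by rewrite ltr0n.
exists (\sum_(k < n.+1)
  ('C(n, k)%:R * f (k%:R / n%:R)) *: ((1 - 'X) ^+ (n - k) * 'X ^+ k)).
move=> w w01; have /andP[w0 w1] := w01.
rewrite horner_sum (_ : \sum_(_ < _) _ = bsum n (1 - w) w (fun k => f (k%:R / n%:R))); last first.
  rewrite /bsum /lsum; apply: eq_bigr => k _.
  by rewrite hornerZ hornerM !horner_exp !hornerE /= ?mulrA [RHS]mulrAC;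
    congr (_ * _); rewrite mulrAC.
have fw : f w = bsum n (1 - w) w (fun=> f w).
  have -> : bsum n (1 - w) w (fun=> f w) = f w * bsum n (1 - w) w (fun=> 1).
    by rewrite /bsum /lsum mulr_sumr; apply: eq_bigr => k _; rewrite mulr1 mulrA mulrC.
  by rewrite bsum_const ?subrK ?mulr1.
rewrite fw /bsum /lsum -sumrB -/(lsum _ _) -/(bsum _ _ _ _).
apply: (@le_trans _ _ (bsum n (1 - w) w
    (fun k => e / 2 + C / n%:R ^+ 2 * (k%:R - n%:R * w) ^+ 2))).
  rewrite (le_trans (ler_norm_sum _ _ _))// /bsum /lsum ler_sum// => k _.
  have ge0 : 0 <= 'C(n, k)%:R * (1 - w) ^+ (n - k) * w ^+ k.
    by rewrite !mulr_ge0 ?exprn_ge0 ?subr_ge0.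
  rewrite /= !['C(n, k)%:R * (_ * _)]mulrA -mulrBr normrM (ger0_norm ge0) ler_wpM2l//.
  rewrite (le_trans (fC _ _ w01 _))//.
    rewrite divr_ge0//= ler_pdivrMr// mul1r ler_nat; have := ltn_ord k; lia.
  rewrite lerD2l// -mulrA ler_wpM2l ?(ltW C0)// -exprVn -exprMn.
  by rewrite mulrBr mulrA mulVf ?gt_eqF// mul1r mulrC.
have -> : bsum n (1 - w) w (fun k => e / 2 + C / n%:R ^+ 2 * (k%:R - n%:R * w) ^+ 2) =
    e / 2 * bsum n (1 - w) w (fun=> 1) +
    C / n%:R ^+ 2 * bsum n (1 - w) w (fun k => (k%:R - n%:R * w) ^+ 2).
  rewrite /bsum /lsum !mulr_sumr -big_split/=; apply: eq_bigr => k _.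
  by set c := _%:R; set d1 := _ ^+ _ * _; ring.
rewrite bsum_const ?subrK// mulr1 bsum_variance subrr expr0n/= addr0.
rewrite [leRHS]splitr lerD2l.
have -> : C / n%:R ^+ 2 * (n%:R * w * (1 - w)) = C / n%:R * (w * (1 - w)).
  by rewrite expr2 invfM -!mulrA mulKf ?gt_eqF.
rewrite (@le_trans _ _ (C / n%:R))//; last by rewrite ler_pdivrMr.
by rewrite ler_piMr ?divr_ge0 ?(ltW C0) ?(ltW n0)//; nra.
Qed.
End Weierstrass.

(** * Approximation by polynomials times an exponential *)

Section ExponentialApproximation.
Context {R : realType}.
Implicit Types (t c e : R) (A n : nat).

Lemma weight_expR_bound A c : 0 < c ->
  exists2 C : R, 0 < C & forall t, 0 <= t -> (1 + t) ^+ A * expR (- (c * t)) <= C.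
Proof.
(* A share of the exponent for each factor: 1 + t <= (1 + 1/k) e^(kt), and A such factors cost at
   most e^(ct). The successor covers A = 0. *)
move=> c0; pose k : R := c / A.+1%:R.
have k0 : 0 < k by rewrite divr_gt0.
have kge0 := ltW k0; have kV : 0 <= k^-1 by rewrite invr_ge0.
exists ((1 + k^-1) ^+ A).
  by rewrite exprn_gt0// addr_gt0// invr_gt0.
move=> t t0; rewrite expRN ler_pdivrMr ?expR_gt0//.
have h : 1 + t <= (1 + k^-1) * expR (k * t).
  rewrite (@le_trans _ _ ((1 + k^-1) * (1 + k * t)))//.
    have -> : (1 + k^-1) * (1 + k * t) = 1 + t + (k^-1 + k * t) by field; rewrite gt_eqF.
    by rewrite lerDl addr_ge0// mulr_ge0.
  by rewrite ler_wpM2l ?expR_ge1Dx// addr_ge0.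
rewrite (@le_trans _ _ (((1 + k^-1) * expR (k * t)) ^+ A))//.
  by rewrite lerXn2r ?nnegrE ?mulr_ge0 ?addr_ge0 ?expR_ge0.
rewrite exprMn ler_wpM2l ?exprn_ge0 ?addr_ge0//.
rewrite -expRM_natl ler_expR mulrA ler_wpM2r//.
by rewrite /k mulrCA ler_piMr ?(ltW c0)// ler_pdivrMr// mul1r ler_nat.
Qed.

Lemma pow_fact_le_expR t n : 0 <= t -> t ^+ n / n`!%:R <= expR t.
Proof.
move=> t0; case: n => [|n].
  by rewrite expr0 fact0 divr1 (le_trans _ (expR_ge1Dx t))// lerDl.
by rewrite (le_trans _ (expR_ge1Dxn n t0))// lerDr.
Qed.

Definition exp_taylor n : {poly R} := \poly_(i < n) ((-1) ^+ i / i`!%:R).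

Lemma deriv_exp_taylor n : (exp_taylor n.+1)^`() = - exp_taylor n.
Proof.
apply/polyP => i; rewrite coef_deriv coefN !coef_poly ltnS.
case: ifP => _; last by rewrite mul0rn oppr0.
rewrite -[LHS]mulr_natr factS natrM exprS mulN1r invfM !mulNr. congr (- _).
by rewrite [_^-1 * _]mulrC mulrA mulfVK// pnatr_eq0.
Qed.

(** The remainder of order n+1 vanishes at 0 and has derivative minus the remainder of order n;
    hence t^(n+1)/(n+1)! plus or minus it is nondecreasing on t >= 0. *)
Lemma expR_taylor_remainder n t : 0 <= t ->
  `|expR (- t) - (exp_taylor n).[t]| <= t ^+ n / n`!%:R.
Proof.
elim: n t => [|n IH] t t0.
  rewrite /exp_taylor poly_def big_ord0 horner0 subr0 fact0 expr0 divr1.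
  by rewrite ger0_norm ?expR_ge0// expR_le1 oppr_le0.
have d0 (s : R) : is_derive s (1 : R) (fun s : R => expR (- s) - (exp_taylor n.+1).[s])
    (- (expR (- s) - (exp_taylor n).[s])).
  have h := derB (der_expR (derN (is_derive_id s (1 : R)))) (is_derive_poly (exp_taylor n.+1) s).
  by apply: (der_eq h); rewrite deriv_exp_taylor hornerN; ring.
have r0 : expR (- 0) - (exp_taylor n.+1).[0] = 0 :> R.
  by rewrite horner_coef0 coef_poly/= oppr0 expR0 fact0 expr0 divr1 subrr.
have d1 (s : R) : is_derive s (1 : R) (fun s : R => s ^+ n.+1 / n.+1`!%:R) (s ^+ n / n`!%:R).
  under eq_fun do rewrite mulrC.
  apply: (der_eq (derZ _ (derX _ _))); rewrite /= factS natrM invfM.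
  by rewrite [_^-1 * _]mulrC -mulrA mulKf ?pnatr_eq0// mulrC.
rewrite ler_norml; apply/andP; split.
  rewrite -subr_ge0 opprK addrC.
  have := @der_nondecreasing _ (fun s => s ^+ n.+1 / n.+1`!%:R +
    (expR (- s) - (exp_taylor n.+1).[s])) _ 0 t (fun s => derD (d1 s) (d0 s)).
  rewrite r0 expr0n/= mul0r addr0; apply => // s /andP[s0 _].
  by rewrite subr_ge0 (le_trans (ler_norm _)) ?IH ?ltW.
rewrite -subr_ge0.
have := @der_nondecreasing _ (fun s => s ^+ n.+1 / n.+1`!%:R -
    (expR (- s) - (exp_taylor n.+1).[s])) _ 0 t (fun s => derB (d1 s) (d0 s)).
rewrite r0 expr0n/= mul0r subr0; apply => // s /andP[s0 _].
rewrite opprK -lerBlDl sub0r.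
by have := IH _ (ltW s0); rewrite ler_norml => /andP[].
Qed.

Lemma horner_le_weight (p : {poly R}) :
  exists2 C : R, 0 < C & forall t, `|p.[t]| <= C * (1 + `|t|) ^+ size p.
Proof.
exists (1 + \sum_(i < size p) `|p`_i|).
  by rewrite ltr_pwDl// sumr_ge0.
move=> t; rewrite horner_coef mulrDl mul1r ler_wpDl ?exprn_ge0 ?addr_ge0//.
rewrite mulr_suml (le_trans (ler_norm_sum _ _ _))// ler_sum// => i _.
rewrite normrM ler_wpM2l// normrX (@le_trans _ _ ((1 + `|t|) ^+ i))//.
  by rewrite lerXn2r ?nnegrE ?addr_ge0 ?lerDr.
by rewrite ler_weXn2l ?lerDl// ltnW.
Qed.

Definition exp_approx A (F : R -> R) := forall e, 0 < e ->
  exists Q : {poly R}, forall t, 0 <= t ->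
    (1 + t) ^+ A * `|F t - Q.[t] * expR (- t)| <= e.

Lemma exp_approxD A F G : exp_approx A F -> exp_approx A G ->
  exp_approx A (fun t => F t + G t).
Proof.
move=> aF aG e e0; have e20 : 0 < e / 2 by rewrite divr_gt0.
have [P hP] := aF _ e20; have [Q hQ] := aG _ e20.
exists (P + Q) => t t0; rewrite [e]splitr.
have -> : F t + G t - (P + Q).[t] * expR (- t) =
  (F t - P.[t] * expR (- t)) + (G t - Q.[t] * expR (- t)) by rewrite hornerD; ring.
apply: le_trans (lerD (hP _ t0) (hQ _ t0)).
by rewrite -mulrDr ler_wpM2l ?ler_normD// exprn_ge0// addr_ge0.
Qed.

Lemma exp_approx_closed A F : (forall e, 0 < e -> exists2 G, exp_approx A G &
    forall t, 0 <= t -> (1 + t) ^+ A * `|F t - G t| <= e) ->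
  exp_approx A F.
Proof.
move=> FG e e0; have e20 : 0 < e / 2 by rewrite divr_gt0.
have [G aG hG] := FG _ e20; have [Q hQ] := aG _ e20.
exists Q => t t0; rewrite [e]splitr.
apply: le_trans (lerD (hG _ t0) (hQ _ t0)).
by rewrite -mulrDr ler_wpM2l ?exprn_ge0 ?addr_ge0// ler_distD.
Qed.

(** Origin of the step 1/4: the Taylor remainder is (t/4)^n/n! = 2^-n (t/2)^n/n! <= 2^-n e^(t/2),
    and e^(-bt) with b >= 1 absorbs e^(t/2) while still leaving e^(-t/2) to beat the polynomial
    weights. *)
Lemma exp_taylor_approx A (b e : R) (P : {poly R}) : 1 <= b -> 0 < e ->
  exists Q : {poly R}, forall t, 0 <= t ->
    (1 + t) ^+ A *
      `|P.[t] * expR (- ((b + 4^-1) * t)) - Q.[t] * expR (- (b * t))| <= e.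
Proof.
move=> b1 e0; have [C C0 hP] := horner_le_weight P.
have [D D0 hD] := @weight_expR_bound (A + size P) 2^-1 ltac:(by rewrite invr_gt0).
pose n := Num.bound (C * D / e).
have hn : C * D / 2 ^+ n <= e.
  rewrite ler_pdivrMr ?exprn_gt0// [e * _]mulrC -ler_pdivrMr//.
  have /ltW h := archi_boundP (ltW (divr_gt0 (mulr_gt0 C0 D0) e0)).
  by rewrite (le_trans h)// -natrX ler_nat ltnW// ltn_expl.
exists (P * (exp_taylor n \Po (4^-1 *: 'X))) => t t0.
have -> : P.[t] * expR (- ((b + 4^-1) * t)) -
    (P * (exp_taylor n \Po (4^-1 *: 'X))).[t] * expR (- (b * t)) =
    P.[t] * expR (- (b * t)) * (expR (- (t / 4)) - (exp_taylor n).[t / 4]).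
  rewrite hornerM horner_comp hornerZ hornerX [4^-1 * t]mulrC mulrDl opprD expRD.
  by rewrite [4^-1 * t]mulrC; ring.
apply: le_trans hn; rewrite !normrM (ger0_norm (expR_ge0 _)).
have t40 : 0 <= t / 4 by rewrite divr_ge0.
have tay : `|expR (- (t / 4)) - (exp_taylor n).[t / 4]| <= expR (t / 2) / 2 ^+ n.
  rewrite (le_trans (expR_taylor_remainder n t40))//.
  have -> : t / 4 = t / 2 / 2 by rewrite -mulrA -invfM -natrM.
  rewrite expr_div_n mulrAC ler_wpM2r ?invr_ge0 ?exprn_ge0//.
  by rewrite pow_fact_le_expR// divr_ge0.
rewrite (@le_trans _ _ ((1 + t) ^+ A * (C * (1 + t) ^+ size P * expR (- t) *
    (expR (t / 2) / 2 ^+ n))))//.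
  rewrite ler_wpM2l ?exprn_ge0 ?addr_ge0// ler_pM ?mulr_ge0 ?expR_ge0//.
  rewrite ler_pM ?expR_ge0//; first by rewrite (le_trans (hP t))// ger0_norm.
  by rewrite ler_expR lerN2 ler_peMl.
have -> : (1 + t) ^+ A * (C * (1 + t) ^+ size P * expR (- t) *
    (expR (t / 2) / 2 ^+ n)) = C / 2 ^+ n *
    ((1 + t) ^+ (A + size P) * (expR (- t) * expR (t / 2))) by rewrite exprD; ring.
rewrite -expRD (_ : - t + t / 2 = - (2^-1 * t)); last by field.
by rewrite [leRHS]mulrAC ler_wpM2l ?hD// divr_ge0 ?exprn_ge0 ?(ltW C0).
Qed.

(** The exponent comes down to 1 by quarters. The polynomial is arbitrary because every step
    multiplies it by a Taylor polynomial. *)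
Lemma exp_approx_expM A m (P : {poly R}) :
  exp_approx A (fun t => P.[t] * expR (- ((1 + m%:R / 4) * t))).
Proof.
elim: m P => [|m IH] P.
  by move=> e e0; exists P => t t0; rewrite mul0r addr0 mul1r subrr normr0 mulr0 ltW.
apply: exp_approx_closed => e e0.
have [|Q hQ] := @exp_taylor_approx A (1 + m%:R / 4) e P _ e0.
  by rewrite lerDl divr_ge0.
exists (fun t => Q.[t] * expR (- ((1 + m%:R / 4) * t))) => // t t0.
by rewrite (_ : 1 + m.+1%:R / 4 = 1 + m%:R / 4 + 4^-1) ?hQ// -natr1; ring.
Qed.

Lemma exp_approx_horner A (W : {poly R}) :
  exp_approx A (fun t => expR (- t) * W.[expR (- (t / 4))]).
Proof.
have -> : (fun t => expR (- t) * W.[expR (- (t / 4))]) =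
    fun t => \sum_(i < size W) expR (- t) * (W`_i * expR (- (t / 4)) ^+ i).
  by apply/funext => t; rewrite horner_coef mulr_sumr.
elim: (size W) => [|n IH].
  by move=> e e0; exists 0 => t t0; rewrite big_ord0 horner0 mul0r subrr normr0 mulr0 ltW.
have -> : (fun t => \sum_(i < n.+1) expR (- t) * (W`_i * expR (- (t / 4)) ^+ i)) =
    fun t => (\sum_(i < n) expR (- t) * (W`_i * expR (- (t / 4)) ^+ i)) +
      expR (- t) * (W`_n * expR (- (t / 4)) ^+ n).
  by apply/funext => t; rewrite big_ord_recr.
apply: exp_approxD => //.
have := @exp_approx_expM A n (W`_n)%:P; congr (exp_approx A _).
apply/funext => t; rewrite hornerC -expRM_natl mulrCA -expRD.
by congr (_ * expR _); field.
Qed.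

End ExponentialApproximation.

(** * Even decaying functions as limits of Gaussian polynomials *)

Section GaussDensity.
Context {R : realType}.
Implicit Types (q e : R) (A n : nat).

Definition rdecays (f : R -> R) : Prop := forall A, exists M : R,
  forall q, (1 + q ^+ 2) ^+ A * `|f q| <= M.

(** As a function of w = e^(-t/4), H e^t need not extend continuously to w = 0, so H is first cut
    off at large q, where the decay of H makes this harmless. The error splits into three thirds:
    the cutoff, Weierstrass' theorem in w, and the replacement of powers of w by polynomials in
    t. *)
Lemma gauss_approx_even (H : R -> R) A e : continuous H ->
    (forall q, H (- q) = H q) -> rdecays H -> 0 < e ->
  exists P : {poly R}, forall q,
    (1 + q ^+ 2) ^+ A * `|H q - P.[q ^+ 2 / 2] * expR (- (q ^+ 2 / 2))| <= e.
Proof.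
move=> Hc He Hd e0.
have e30 : 0 < e / 3 by rewrite divr_gt0.
have w_ge0 q : 0 <= (1 + q ^+ 2) ^+ A by rewrite exprn_ge0// addr_ge0// sqr_ge0.
have [M HM] := Hd A.+1.
(* With one spare weight, (1 + q^2)^A |H q| is at most M/(1 + q^2), hence at most e/3 once 1 + q^2
   >= K. The choice of d makes w < 2d mean t/4 > K, which implies this. *)
pose K := `|M| / (e / 3).
have K0 : 0 <= K by rewrite divr_ge0// ltW.
pose d : R := expR (- K) / 2.
have d0 : 0 < d by rewrite divr_gt0 ?expR_gt0.
(* [G] is the function H e^t of w = e^(-t/4), multiplied by the cutoff [c]; the
   truncation at [d] makes it continuous on the whole line. *)
pose c (w : R) : R := Num.max 0 (Num.min 1 (w / d - 1)).
pose G (w : R) : R := H (Num.sqrt (- (8 * ln (Num.max w d)))) *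
  (Num.max w d ^+ 4)^-1 * c w.
have maxc : continuous (fun w : R => Num.max w d).
  by move=> x; apply: (@continuous_max _ _ id (cst d)); [exact: cvg_id|exact: cvg_cst].
have md0 w : 0 < Num.max w d by rewrite lt_max d0 orbT.
have cc : continuous c.
  move=> x; apply: (@continuous_max _ _ (cst (0 : R)) (fun w : R => Num.min 1 (w / d - 1)));
    first exact: cvg_cst.
  apply: (@continuous_min _ _ (cst (1 : R)) (fun w : R => w / d - 1)); first exact: cvg_cst.
  by apply: cvgB; [apply: cvgM; [exact: cvg_id|exact: cvg_cst]|exact: cvg_cst].
have Gc : continuous G.
  move=> w; apply: cvgM; first apply: cvgM.
  - apply: continuous_cvg; first exact: Hc.
    apply: continuous_cvg; first exact: sqrt_continuous.
    apply: cvgN; apply: cvgM; first exact: cvg_cst.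
    by apply: continuous_cvg; [exact: continuous_ln|exact: maxc].
  - apply: cvgV; first by rewrite expf_neq0 ?gt_eqF.
    by apply: (@continuous_cvg _ _ _ _ _ _ (fun x : R => x ^+ 4)); [exact: exprn_continuous|exact: maxc].
  - exact: cc.
have [C C0 hC] := @weight_expR_bound R A 1 ltr01.
have Ce0 : 0 < e / 3 / (2 ^+ A * C) by rewrite divr_gt0// mulr_gt0.
have A0 : 0 < (2 : R) ^+ A by rewrite exprn_gt0.
have wt q : (1 + q ^+ 2) ^+ A <= 2 ^+ A * (1 + q ^+ 2 / 2) ^+ A.
  rewrite -exprMn lerXn2r ?nnegrE ?mulr_ge0 ?addr_ge0 ?divr_ge0 ?sqr_ge0//.
  by rewrite mulrDr mulr1 mulrCA divff// mulr1 lerD2r ler1n.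
have [W hW] := weierstrass_itv01 Gc Ce0.
have [P hP] := @exp_approx_horner R A W (e / 3 / 2 ^+ A) (divr_gt0 e30 A0).
exists P => q.
pose t := q ^+ 2 / 2.
have t0 : 0 <= t by rewrite divr_ge0 ?sqr_ge0.
pose w : R := expR (- (t / 4)).
have w01 : 0 <= w <= 1.
  by rewrite expR_ge0 expR_le1 oppr_le0 divr_ge0.
have c01 : 0 <= c w <= 1.
  by rewrite /c le_max lexx/= ge_max ler01 ge_min lexx.
have /andP[c0 c1] := c01.
(* For w > d, -8 ln w = q^2 and w^-4 = e^t, while evenness replaces H(|q|) by H(q); for w <= d the
   cutoff kills both sides. *)
have GH : expR (- t) * G w = H q * c w.
  rewrite /G; have [wd|dw] := leP w d.
    rewrite (_ : c w = 0) ?mulr0//; apply/max_idPl.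
    by rewrite ge_min subr_le0 ler_pdivrMr// mul1r wd orbT.
  rewrite /w expRK -expRM_natl.
  have -> : - (8 * - (t / 4)) = q ^+ 2 by rewrite /t; field.
  rewrite sqrtr_sqr (_ : H `|q| = H q); last by case: ger0P; rewrite ?He.
  rewrite -expRN mulrA mulrCA -expRD (_ : - t + - (4 * - (t / 4)) = 0) ?expR0 ?mulr1//.
  by field.
have mid : (1 + q ^+ 2) ^+ A * `|expR (- t) * (G w - W.[w])| <= e / 3.
  rewrite normrM mulrA (@le_trans _ _ (2 ^+ A * C * `|G w - W.[w]|))//; last first.
    by rewrite mulrC -ler_pdivlMr ?mulr_gt0// hW.
  rewrite ler_wpM2r// (ger0_norm (expR_ge0 _)).
  rewrite (@le_trans _ _ (2 ^+ A * (1 + t) ^+ A * expR (- t)))//.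
    by rewrite ler_wpM2r ?expR_ge0// wt.
  by rewrite -mulrA ler_wpM2l ?(ltW A0)//; have := hC _ t0; rewrite mul1r.
have fin : (1 + q ^+ 2) ^+ A * `|expR (- t) * W.[w] - P.[t] * expR (- t)| <= e / 3.
  rewrite (@le_trans _ _ (2 ^+ A * (1 + t) ^+ A * `|expR (- t) * W.[w] - P.[t] * expR (- t)|))//.
    by rewrite ler_wpM2r// wt.
  by rewrite -mulrA -ler_pdivlMl// [leRHS]mulrC hP.
rewrite -/t (_ : e = e / 3 + (e / 3 + e / 3)); last by field.
have -> : H q - P.[t] * expR (- t) = (H q - H q * c w) +
   (expR (- t) * (G w - W.[w]) + (expR (- t) * W.[w] - P.[t] * expR (- t))).
  by rewrite mulrBr GH; ring.
apply: (@le_trans _ _ ((1 + q ^+ 2) ^+ A * (`|H q - H q * c w| +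
   (`|expR (- t) * (G w - W.[w])| + `|expR (- t) * W.[w] - P.[t] * expR (- t)|)))).
  by rewrite ler_wpM2l// (le_trans (ler_normD _ _))// lerD2l ler_normD.
rewrite mulrDr; apply: lerD; last by rewrite mulrDr; apply: lerD; [exact: mid|exact: fin].
have [w2d|dw] := ltP w (2 * d); last first.
    rewrite (_ : c w = 1); first by rewrite mulr1 subrr normr0 mulr0 ltW.
    rewrite /c; apply/eqP; rewrite eq_le c1/= le_max; apply/orP; right.
    by rewrite le_min lexx lerBrDr -[1 + 1]/2 ler_pdivlMr.
  have Kq : K <= 1 + q ^+ 2.
    move: w2d; rewrite /w /d mulrCA divff// mulr1 ltr_expR ltrN2 /t => Kt.
    by have := sqr_ge0 q; lra.
  have -> : H q - H q * c w = H q * (1 - c w) by ring.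
  rewrite (@le_trans _ _ ((1 + q ^+ 2) ^+ A * `|H q|))//.
    by rewrite ler_wpM2l// normrM ler_piMr// ger0_norm ?subr_ge0// gerBl.
  have q10 : 0 < 1 + q ^+ 2 by rewrite ltr_wpDr// sqr_ge0.
  have := HM q; rewrite exprS -mulrA -ler_pdivlMl// => /le_trans; apply.
  rewrite ler_pdivrMl// (le_trans (ler_norm _))//.
  by rewrite -ler_pdivrMr.
Qed.

End GaussDensity.

(** * Chains for the operator q^-1 d/dq *)

Section ChainDensity.
Context {R : realType}.
Implicit Types (q e : R) (A n : nat).

Definition rchain (D : nat -> R -> R) : Prop :=
  forall n q, is_derive q (1 : R) (D n) (q * D n.+1 q).

Lemma weight_gt0 A q : 0 < (1 + q ^+ 2) ^+ A.
Proof. by rewrite exprn_gt0// ltr_wpDr// sqr_ge0. Qed.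

Lemma weight_ge1 A q : 1 <= (1 + q ^+ 2) ^+ A.
Proof. by rewrite exprn_ege1// lerDl sqr_ge0. Qed.

Lemma weight_le A n q : (A <= n)%N -> (1 + q ^+ 2) ^+ A <= (1 + q ^+ 2) ^+ n.
Proof. by move=> An; rewrite ler_weXn2l// lerDl sqr_ge0. Qed.

Lemma der_weightV A q : is_derive q (1 : R) (fun q => ((1 + q ^+ 2) ^+ A.+1)^-1)
  (- (2 * A.+1%:R * q / (1 + q ^+ 2) ^+ A.+2)).
Proof.
have q0 : 1 + q ^+ 2 != 0 :> R by rewrite gt_eqF// ltr_wpDr// sqr_ge0.
have dw : is_derive q (1 : R) (fun q => 1 + q ^+ 2) (0 + 2%:R * q ^+ 1).
  exact: derD (is_derive_cst _ _ _) (derX _ _).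
have dwA := der_comp (f := fun x => x ^+ A.+1) (derX A.+1 _) dw.
have w0 : (1 + q ^+ 2) ^+ A != 0 by rewrite expf_neq0.
have w10 : (1 + q ^+ 2) ^+ A.+1 != 0 by rewrite expf_neq0.
apply: (der_eq (@is_deriveV R (fun q => (1 + q ^+ 2) ^+ A.+1) q _ 1 w10 dwA)).
rewrite /GRing.scale/= add0r expr1 (exprS _ A.+1) (exprS _ A) /=.
move: w0 q0 {w10 dwA dw}; move: (1 + q ^+ 2) => x; move: (x ^+ A) => y w0 q0.
by field; rewrite q0 w0.
Qed.

(* Compare [f] with [e / (2 (A + 1)) (1 + q^2)^-(A+1)]: both tend to 0 at infinity. *)
Lemma integrate_weight (f g : R -> R) A e :
    (forall q, is_derive q (1 : R) f (q * g q)) -> (forall q, f (- q) = f q) ->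
    rdecays f -> 0 <= e ->
    (forall q, (1 + q ^+ 2) ^+ A.+2 * `|g q| <= e) ->
  forall q, (1 + q ^+ 2) ^+ A.+1 * `|f q| <= e.
Proof.
move=> fd fe fdec e0 ge.
suff H q : 0 <= q -> (1 + q ^+ 2) ^+ A.+1 * `|f q| <= e.
  move=> q; have [|q0] := leP 0 q; first exact: H.
  by rewrite -(fe q) -(sqrrN q); apply: H; rewrite oppr_ge0 ltW.
move=> q0; pose phi (x : R) := e / (2 * A.+1%:R) * ((1 + x ^+ 2) ^+ A.+1)^-1.
have dphi x : is_derive x (1 : R) phi (- (e * x / (1 + x ^+ 2) ^+ A.+2)).
  apply: (der_eq (derZ _ (der_weightV A x))).
  by have := weight_gt0 A.+2 x; move: (_ ^+ A.+2) => w w0; field; rewrite gt_eqF//= addrC natr1.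
have gle x : 0 <= x -> `|x * g x| <= e * x / (1 + x ^+ 2) ^+ A.+2.
  move=> x0; rewrite normrM ger0_norm// ler_pdivlMr ?weight_gt0//.
  by rewrite [e * x]mulrC -mulrA ler_wpM2l// mulrC ge.
(* The function phi + s f is nonincreasing to the right of q and tends to 0, hence cannot be
   negative at q. *)
have phi0 (s : R) : (s = 1 \/ s = -1) -> 0 <= phi q + s * f q.
  move=> s1.
  have dh x : is_derive x (1 : R) (fun x => - (phi x + s * f x))
      (- (- (e * x / (1 + x ^+ 2) ^+ A.+2) + s * (x * g x))).
    by apply: derN; apply: derD => //; exact: derZ.
  have hmono r : q <= r -> phi r + s * f r <= phi q + s * f q.
    move=> qr; rewrite -lerN2.
    apply: (der_nondecreasing dh _ qr) => x /andP[qx _].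
    rewrite opprD opprK subr_ge0 (le_trans (ler_norm _))//.
    rewrite normrM (_ : `|s| = 1) ?mul1r ?gle//; first exact: le_trans q0 (ltW qx).
    by case: s1 => ->; rewrite ?normrN normr1.
  rewrite leNgt; apply/negP => neg.
  have [M hM] := fdec 1%N.
  pose d := - (phi q + s * f q).
  have d0 : 0 < d by rewrite oppr_gt0.
  (* Far enough that d r >= |M| + 1, whereas r |f r| <= M; hence |f r| < d. *)
  pose r := q + (`|M| + 1) / d + 1.
  have Md0 : 0 < (`|M| + 1) / d by rewrite divr_gt0// ltr_wpDl.
  have qr : q <= r by rewrite /r -addrA lerDl addr_ge0 ?ltW.
  have := hmono _ qr; rewrite leNgt => /negP; apply.
  have -> : phi q + s * f q = - d by rewrite opprK.
  have phir : 0 <= phi r by rewrite mulr_ge0 ?invr_ge0 ?(ltW (weight_gt0 _ _))// divr_ge0.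
  have sf : `|s * f r| < d.
    rewrite normrM (_ : `|s| = 1) ?mul1r; last by case: s1 => ->; rewrite ?normrN normr1.
    have := hM r; rewrite expr1 mulrC => h.
    have r1 : r <= 1 + r ^+ 2 by have := sqr_ge0 (r - 1); have := sqr_ge0 (r + 1); nra.
    have r0 : 0 < r by rewrite /r ltr_wpDl// addr_ge0// ltW.
    have rd : `|M| + 1 <= d * r.
      by rewrite mulrC -ler_pdivrMr// /r; lra.
    rewrite -(ltr_pM2r r0) (@le_lt_trans _ _ M)//.
      by rewrite (le_trans _ h)// ler_wpM2l.
    by rewrite (lt_le_trans _ rd)// (le_lt_trans (ler_norm _))// ltrDl.
  by move: sf; rewrite ltr_norml => /andP[sf _]; rewrite ltr_wpDl.
have := phi0 1 (or_introl erefl); have := phi0 (-1) (or_intror erefl).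
rewrite mul1r mulN1r subr_ge0 => h1 h2.
have : `|f q| <= phi q by rewrite ler_norml h1 andbT -subr_ge0 opprK addrC.
move=> /(ler_wpM2l (ltW (weight_gt0 A.+1 q)))/le_trans; apply.
rewrite /phi mulrCA divff ?gt_eqF ?weight_gt0// mulr1.
by rewrite ler_pdivrMr// ler_peMr// -natrM ler1n.
Qed.

Definition gop (K : nzRingType) (P : {poly K}) : {poly K} := P^`() - P.

(** The inverse of the derivation minus the identity is minus its Neumann series, which is finite on
    a polynomial. *)
Lemma gop_surj (K : nzRingType) (Q : {poly K}) : exists P, gop P = Q.
Proof.
exists (- \sum_(i < size Q) Q^`(i)); rewrite /gop derivN raddf_sum opprK addrC.
rewrite -sumrB (eq_bigr (fun i : 'I__ => - (Q^`(i.+1) - Q^`(i)))); last first.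
  by move=> i _; rewrite opprB derivnS.
rewrite sumrN -(big_mkord xpredT (fun i => Q^`(i.+1) - Q^`(i))) telescope_sumr//.
by rewrite opprB derivn0 derivn_poly0 ?leqnn// subr0.
Qed.

Lemma iter_gop_surj (K : nzRingType) n (Q : {poly K}) : exists P, iter n (@gop K) P = Q.
Proof.
elim: n Q => [|n IH] Q; first by exists Q.
by have [P <-] := gop_surj Q; have [P' <-] := IH P; exists P'; rewrite iterS.
Qed.

(* The [n]-th iterate of [q^-1 d/dq] on [P(q^2/2) e^(-q^2/2)]. *)
Definition rgauss (P : {poly R}) n q : R :=
  (iter n (@gop R) P).[q ^+ 2 / 2] * expR (- (q ^+ 2 / 2)).

Lemma rgauss_chain P : rchain (rgauss P).
Proof.
move=> n q; rewrite /rgauss iterS; set p := iter n _ P.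
have dt : is_derive q (1 : R) (fun q => q ^+ 2 / 2) q.
  under eq_fun do rewrite mulrC.
  by apply: (der_eq (derZ _ (derX _ _))); rewrite /= expr1; field.
apply: (der_eq (derM (der_comp (is_derive_poly p _) dt) (der_expR (derN dt)))).
by rewrite /gop hornerD hornerN /=; ring.
Qed.

Lemma rdecaysB (f g : R -> R) : rdecays f -> rdecays g -> rdecays (fun q => f q - g q).
Proof.
move=> df dg A; have [M hM] := df A; have [N hN] := dg A; exists (M + N) => q.
rewrite (le_trans _ (lerD (hM q) (hN q)))// -mulrDr ler_wpM2l ?(ltW (weight_gt0 _ _))//.
exact: ler_normB.
Qed.

Lemma rgauss_decays P n : rdecays (rgauss P n).
Proof.
move=> A; rewrite /rgauss; set p := iter n _ P.
have [C C0 hC] := horner_le_weight p.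
have [E E0 hE] := @weight_expR_bound R (A + size p) 1 ltr01.
exists (2 ^+ A * C * E) => q; set t := q ^+ 2 / 2.
have t0 : 0 <= t by rewrite divr_ge0 ?sqr_ge0.
have := hE _ t0; rewrite mul1r exprD => h.
rewrite -(ler_pM2l (mulr_gt0 (exprn_gt0 A (ltr0n R 2)) C0)) in h.
rewrite (le_trans _ h)// normrM (ger0_norm (expR_ge0 _)).
have := hC t; rewrite (ger0_norm t0) => {}hC.
have wt : (1 + q ^+ 2) ^+ A <= 2 ^+ A * (1 + t) ^+ A.
  rewrite -exprMn lerXn2r ?nnegrE ?mulr_ge0 ?addr_ge0 ?sqr_ge0//.
  by rewrite mulrDr mulr1 mulrCA divff// mulr1 lerD2r ler1n.
rewrite (_ : _ * (_ * _ * _) = (2 ^+ A * (1 + t) ^+ A) *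
  (C * (1 + t) ^+ size p * expR (- t))); last by ring.
by rewrite ler_pM ?mulr_ge0 ?expR_ge0 ?(ltW (weight_gt0 _ _))// ler_wpM2r ?expR_ge0.
Qed.

Lemma rchain_approx (D : nat -> R -> R) m A e : rchain D ->
    (forall n q, D n (- q) = D n q) -> (forall n, rdecays (D n)) -> 0 < e ->
  exists P : {poly R}, forall j q, (j <= m)%N ->
    (1 + q ^+ 2) ^+ A * `|D j q - rgauss P j q| <= e.
Proof.
move=> Dc De Dd e0.
(* Each of the m integrations from D m down to D 0 costs one weight; the extra one keeps the
   exponent positive, as [integrate_weight] demands. *)
have [|Q hQ] := @gauss_approx_even R (D m) (A.+1 + m) e _ (De m) (Dd m) e0.
  by move=> q; exact: der_continuous (Dc m q).
have [P PQ] := iter_gop_surj m Q; exists P.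
suff H k : (k <= m)%N -> forall q,
    (1 + q ^+ 2) ^+ (A.+1 + (m - k)) * `|D (m - k)%N q - rgauss P (m - k) q| <= e.
  move=> j q jm; rewrite (le_trans _ (H (m - j)%N (leq_subr _ _) q))// subKn//.
  by rewrite ler_wpM2r// weight_le// addSn leqW// leq_addr.
elim: k => [|k IH] km q; first by rewrite subn0 /rgauss PQ.
pose F n (q : R) := D n q - rgauss P n q.
apply: (@integrate_weight (F (m - k.+1)%N) (F (m - k)%N)) => [x|x|||x].
- apply: (der_eq (derB (Dc _ x) (rgauss_chain P _ x))).
  by rewrite -mulrBr subnSK.
- by rewrite /F /rgauss De sqrrN.
- by apply: rdecaysB => //; exact: rgauss_decays.
- exact: ltW.
- have := IH (ltnW km) x; rewrite -(subnSK km) addnS addSn; exact.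
Qed.

End ChainDensity.

(** * Division by q *)

Section Hadamard.
Context {R : realType}.
Implicit Types (q e : R) (A n : nat).

Lemma rdecays_tail (f : R -> R) : continuous f ->
  (forall A, exists M : R, forall q, 1 <= `|q| -> (1 + q ^+ 2) ^+ A * `|f q| <= M) ->
  rdecays f.
Proof.
move=> fc H A; have [M hM] := H A.
have gc : {within `[-1, 1], continuous (fun q : R => `|f q|)}.
  by apply: continuous_subspaceT => x; apply: continuous_cvg;
    [exact: norm_continuous|exact: fc].
have [|c _ hc] := EVT_max _ gc; first by lra.
exists (`|M| + 2 ^+ A * `|f c|) => q.
have [q1|q1] := leP 1 `|q|.
  rewrite (le_trans (hM _ q1))// (le_trans (ler_norm _))// lerDl.
  by rewrite mulr_ge0// exprn_ge0.
rewrite ler_wpDl// ler_pM ?exprn_ge0 ?addr_ge0 ?sqr_ge0//.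
  rewrite lerXn2r ?nnegrE ?addr_ge0 ?sqr_ge0//.
  by rewrite -[2]/(1 + 1) lerD2l -real_normK ?num_real// expr_le1// ltW.
by apply: hc; rewrite in_itv/= -ler_norml ltW.
Qed.

Variable F : nat -> R -> R.
Hypothesis dF : forall n q, is_derive q (1 : R) (F n) (F n.+1 q).
Hypothesis F00 : F 0%N 0 = 0.

(* [hadamard_num n q] is [\int_0^q s^n F_(n+1)(s) ds], that is, [q^(n+1)] times
   the [n]-th derivative of [F 0 q / q]. *)
Fixpoint hadamard_num n q : R :=
  if n is m.+1 then q ^+ m.+1 * F m.+1 q - m.+1%:R * hadamard_num m q
  else F 0%N q.

(** The value at 0 is the n-th derivative there that the Taylor expansion of [F 0] prescribes for
    the quotient by q. *)
Definition hadamard n q : R :=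
  if q == 0 then F n.+1 0 / n.+1%:R else hadamard_num n q / q ^+ n.+1.

Lemma der_hadamard_num n q :
  is_derive q (1 : R) (hadamard_num n) (q ^+ n * F n.+1 q).
Proof.
elim: n q => [|n IH] q; first by rewrite expr0 mul1r; exact: dF.
apply: (der_eq (derB (derM (derX n.+1 q) (dF n.+1 q)) (derZ n.+1%:R (IH q)))).
by rewrite /=; ring.
Qed.

Lemma hadamard_num0 n : hadamard_num n 0 = 0.
Proof. by elim: n => //= n ->; rewrite expr0n mul0r mulr0 subrr. Qed.

Lemma der_hadamard_neq0 n q : q != 0 ->
  is_derive q (1 : R) (hadamard n) (hadamard n.+1 q).
Proof.
move=> q0.
have qn0 : q ^+ n.+1 != 0 by rewrite expf_neq0.
have h := derM (der_hadamard_num n q)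
  (@is_deriveV R (fun x => x ^+ n.+1) q _ 1 qn0 (derX n.+1 q)).
apply: (@near_eq_is_derive _ _ _ (fun x => hadamard_num n x * (x ^+ n.+1)^-1)).
  have : nbhs q [set x | x != 0] by apply: open_nbhs_nbhs; split => //; exact: open_neq.
  by apply: filterS => x /= x0; rewrite /hadamard (negbTE x0).
apply: (der_eq h); rewrite /hadamard (negbTE q0) /= /GRing.scale/=.
rewrite (exprS _ n.+1) (exprS _ n).
have w0 : q ^+ n != 0 by rewrite expf_neq0.
by move: w0 q0; move: (q ^+ n) => w w0 q0; field; rewrite q0 w0.
Qed.

(** This is the difference quotient of [hadamard n] at 0. If g is the Caratheodory slope of [F n.+1]
    at 0, the numerator has derivative x^(n+1) g(x), and l'Hopital's rule leaves g(x)/(n+2). *)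
Lemma hadamard_num_cvg n :
  (hadamard_num n q - F n.+1 0 / n.+1%:R * q ^+ n.+1) / q ^+ n.+2 @[q --> 0^']
    --> F n.+2 0 / n.+2%:R.
Proof.
have /is_derive1_caratheodory[g [gE gc g0]] := dF n.+1 0.
(* The value 1 at 0 is a placeholder making [dg] nonzero everywhere; derivatives are only compared
   off 0. *)
pose dg (x : R) : R := if x == 0 then 1 else n.+2%:R * x ^+ n.+1.
pose df (x : R) : R := dg x * (g x / n.+2%:R).
have dgn0 x : dg x != 0.
  rewrite /dg; case: ifP => [_|/negbT x0]; first by rewrite oner_eq0.
  by rewrite mulf_eq0 negb_or pnatr_eq0 expf_neq0.
have Fn : n.+1%:R != 0 :> R by rewrite pnatr_eq0.
have Fn2 : n.+2%:R != 0 :> R by rewrite pnatr_eq0.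
pose N (x : R) : R := hadamard_num n x - F n.+1 0 / n.+1%:R * x ^+ n.+1.
have dN x : is_derive x (1 : R) N (x ^+ n.+1 * g x).
  apply: (der_eq (derB (der_hadamard_num n x) (derZ _ (derX n.+1 x)))).
  rewrite /= mulrA mulfVK// [F _ _ * _]mulrC -mulrBr gE subr0 exprS; ring.
apply: (@lhopital R N df (fun x => x ^+ n.+2) dg (-1) 1 0).
- by rewrite in_itv/=; apply/andP; split; lra.
- move=> x; rewrite inE => -[_ /= /eqP x0].
  apply: (der_eq (dN x)).
  by rewrite /df /dg (negbTE x0); field.
- move=> x; rewrite inE => -[_ /= /eqP x0].
  by apply: (der_eq (derX n.+2 x)); rewrite /dg (negbTE x0).
- have N0 : N 0 = 0 by rewrite /N hadamard_num0 expr0n mulr0 subr0.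
  have : N x @[x --> (0 : R)] --> N 0 := der_continuous (dN 0).
  by rewrite N0.
- have : x ^+ n.+2 @[x --> (0 : R)] --> (0 : R) ^+ n.+2 :=
    der_continuous (derX _ _).
  by rewrite [X in _ --> X]expr0n.
- by move=> x _; exact: dgn0.
- have -> : (fun x => df x / dg x) = fun x => g x / n.+2%:R.
    by apply/funext => x; rewrite /df mulrAC divff ?mul1r.
  by rewrite -g0; apply: cvgM; [exact: gc|exact: cvg_cst].
Qed.

Lemma der_hadamard n q : is_derive q (1 : R) (hadamard n) (hadamard n.+1 q).
Proof.
have [->|] := eqVneq q 0; last exact: der_hadamard_neq0.
rewrite {2}/hadamard eqxx; apply/is_derive1_caratheodory.
exists (fun x => if x == 0 then F n.+2 0 / n.+2%:R else
  (hadamard_num n x - F n.+1 0 / n.+1%:R * x ^+ n.+1) / x ^+ n.+2).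
split; last by rewrite eqxx.
- move=> x; rewrite /hadamard eqxx subr0; case: eqVneq => [->|x0].
    by rewrite subrr mulr0.
  rewrite (exprS _ n.+1) (exprS _ n).
  have w0 : x ^+ n != 0 by rewrite expf_neq0.
  have n0 : n.+1%:R != 0 :> R by rewrite pnatr_eq0.
  move: w0 x0 n0; move: (x ^+ n) (n.+1%:R) => w k w0 x0 k0.
  by field; rewrite ?k0 ?x0 ?w0.
- apply/continuous_withinNx; rewrite eqxx.
  apply: (cvg_trans _ (@hadamard_num_cvg n)); apply: near_eq_cvg.
  by near=> x; rewrite ifF//; apply/negbTE; near: x; exact: nbhs_dnbhs_neq.
Unshelve. all: end_near. Qed.

Lemma hadamardE q : F 0%N q = q * hadamard 0 q.
Proof.
rewrite /hadamard; case: eqVneq => [->|q0]; first by rewrite mul0r.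
by rewrite expr1 mulrC mulfVK.
Qed.

(** Leibniz rule for the (n+1)-st derivative of q times the quotient. For |q| >= 1 it bounds each
    derivative by earlier ones, which yields the decay. *)
Lemma mul_hadamardS n q : q * hadamard n.+1 q = F n.+1 q - n.+1%:R * hadamard n q.
Proof.
rewrite /hadamard; case: eqVneq => [->|q0].
  by rewrite mul0r mulrCA divff ?mulr1 ?subrr// pnatr_eq0.
rewrite /= (exprS _ n.+1) (exprS _ n).
have w0 : q ^+ n != 0 by rewrite expf_neq0.
by move: w0 q0; move: (q ^+ n) => w w0 q0; field; rewrite q0 w0.
Qed.

Hypothesis Fd : forall n, rdecays (F n).

Lemma hadamard_decays n : rdecays (hadamard n).
Proof.
apply: rdecays_tail => [x|A]; first exact: der_continuous (der_hadamard n x).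
elim: n => [|n [N hN]].
  have [M hM] := Fd 0 A; exists M => q q1.
  rewrite (le_trans _ (hM q))// ler_wpM2l ?(ltW (weight_gt0 _ _))//.
  by rewrite hadamardE normrM ler_peMl.
have [M hM] := Fd n.+1 A; exists (M + n.+1%:R * N) => q q1.
rewrite (@le_trans _ _ ((1 + q ^+ 2) ^+ A * `|q * hadamard n.+1 q|))//.
  by rewrite ler_wpM2l ?(ltW (weight_gt0 _ _))// normrM ler_peMl.
rewrite mul_hadamardS.
rewrite (@le_trans _ _ ((1 + q ^+ 2) ^+ A * (`|F n.+1 q| + n.+1%:R * `|hadamard n q|)))//.
  rewrite ler_wpM2l ?(ltW (weight_gt0 _ _))// (le_trans (ler_normB _ _))//.
  by rewrite normrM normr_nat.
by rewrite mulrDr lerD// mulrCA ler_wpM2l// hN.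
Qed.

End Hadamard.

(** * Complex-valued Schwartz functions *)

Section ComplexCalculus.
Context {R : realType}.
Implicit Types (q : R) (f g : R -> R[i]) (a b c k : R[i]) (A n : nat).

Lemma ReM a b : complex.Re (a * b) =
  complex.Re a * complex.Re b - complex.Im a * complex.Im b.
Proof. by case: a b => [a1 a2] [b1 b2]. Qed.

Lemma ImM a b : complex.Im (a * b) =
  complex.Re a * complex.Im b + complex.Im a * complex.Re b.
Proof. by case: a b => [a1 a2] [b1 b2]. Qed.

Lemma ReD a b : complex.Re (a + b) = complex.Re a + complex.Re b.
Proof. by case: a b => [a1 a2] [b1 b2]. Qed.

Lemma ImD a b : complex.Im (a + b) = complex.Im a + complex.Im b.
Proof. by case: a b => [a1 a2] [b1 b2]. Qed.

Lemma ReN a : complex.Re (- a) = - complex.Re a.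
Proof. by case: a. Qed.

Lemma ImN a : complex.Im (- a) = - complex.Im a.
Proof. by case: a. Qed.

Lemma complex_ext a b : complex.Re a = complex.Re b -> complex.Im a = complex.Im b ->
  a = b.
Proof. by case: a b => [a1 a2] [b1 b2] /= -> ->. Qed.

Lemma normr_Re_le a : `|complex.Re a| <= normc a.
Proof.
case: a => x y /=; rewrite -sqrtr_sqr ler_wsqrtr// lerDl sqr_ge0//.
Qed.

Lemma normr_Im_le a : `|complex.Im a| <= normc a.
Proof.
case: a => x y /=; rewrite -sqrtr_sqr ler_wsqrtr// lerDr sqr_ge0//.
Qed.

Lemma normc_real (x : R) : normc x%:C = `|x|.
Proof. by rewrite /normc/= expr0n/= addr0 sqrtr_sqr. Qed.

Lemma normc_ge0 a : 0 <= normc a.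
Proof. exact: le_trans (normr_ge0 _) (normr_Re_le a). Qed.

Lemma normc_le a : normc a <= `|complex.Re a| + `|complex.Im a|.
Proof.
rewrite -(@ger0_norm _ (_ + _)) ?addr_ge0// -sqrtr_sqr; case: a => x y /=.
rewrite ler_wsqrtr// sqrrD !real_normK ?num_real// addrAC lerDl.
by rewrite mulrn_wge0// mulr_ge0.
Qed.

Definition cdiff f q l : Prop :=
  is_derive q (1 : R) (fun s => complex.Re (f s)) (complex.Re l) /\
  is_derive q (1 : R) (fun s => complex.Im (f s)) (complex.Im l).

Lemma cdiff_eq f q a b : cdiff f q a -> a = b -> cdiff f q b.
Proof. by move=> ? <-. Qed.

Lemma cderiveE f q a : cdiff f q a -> cderive f q = a.
Proof.
by move=> [h1 h2]; apply: complex_ext; rewrite /cderive/= (der_derive1 h1, der_derive1 h2).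
Qed.

Lemma cdiff_uniq f q a b : cdiff f q a -> cdiff f q b -> a = b.
Proof. by move=> /cderiveE <- /cderiveE. Qed.

Lemma cdiff_cst k q : cdiff (fun=> k) q 0.
Proof. by split; exact: is_derive_cst. Qed.

Lemma cdiffD f g q a b : cdiff f q a -> cdiff g q b ->
  cdiff (fun s => f s + g s) q (a + b).
Proof.
move=> [f1 f2] [g1 g2]; split.
  by under eq_fun do rewrite ReD; rewrite ReD; exact: derD.
by under eq_fun do rewrite ImD; rewrite ImD; exact: derD.
Qed.

Lemma cdiffN f q a : cdiff f q a -> cdiff (fun s => - f s) q (- a).
Proof.
move=> [f1 f2]; split.
  by under eq_fun do rewrite ReN; rewrite ReN; exact: derN.
by under eq_fun do rewrite ImN; rewrite ImN; exact: derN.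
Qed.

Lemma cdiffB f g q a b : cdiff f q a -> cdiff g q b ->
  cdiff (fun s => f s - g s) q (a - b).
Proof. by move=> df dg; apply: cdiffD => //; exact: cdiffN. Qed.

Lemma cdiffM f g q a b : cdiff f q a -> cdiff g q b ->
  cdiff (fun s => f s * g s) q (a * g q + f q * b).
Proof.
move=> [f1 f2] [g1 g2]; split.
  under eq_fun do rewrite ReM.
  by apply: (der_eq (derB (derM f1 g1) (derM f2 g2))); rewrite ReD !ReM; ring.
under eq_fun do rewrite ImM.
by apply: (der_eq (derD (derM f1 g2) (derM f2 g1))); rewrite ImD !ImM; ring.
Qed.

Lemma cdiffZ k f q a : cdiff f q a -> cdiff (fun s => k * f s) q (k * a).
Proof.
by move=> df; apply: (cdiff_eq (cdiffM (cdiff_cst k q) df)); rewrite mul0r add0r.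
Qed.

Lemma cdiff_real (r : R -> R) q (l : R) : is_derive q (1 : R) r l ->
  cdiff (fun s => (r s)%:C) q l%:C.
Proof. by move=> dr; split => //=; exact: is_derive_cst. Qed.

Lemma cdiff_sum (I : Type) (s : seq I) (F : I -> R -> R[i]) (dF : I -> R[i]) q :
  (forall i, cdiff (F i) q (dF i)) ->
  cdiff (fun x => \sum_(i <- s) F i x) q (\sum_(i <- s) dF i).
Proof.
move=> H; elim: s => [|i s IH].
  by rewrite big_nil; under eq_fun do rewrite big_nil; exact: cdiff_cst.
by rewrite big_cons; under eq_fun do rewrite big_cons; exact: cdiffD.
Qed.

Lemma cdiffX n q : cdiff (fun s => s%:C ^+ n) q (n%:R * q%:C ^+ n.-1).
Proof.
under eq_fun do rewrite -rmorphXn.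
by apply: (cdiff_eq (cdiff_real (derX n q))); rewrite rmorphM rmorphXn rmorph_nat.
Qed.

Lemma cdiff_comp f (r : R -> R) q a (l : R) : cdiff f (r q) a ->
  is_derive q (1 : R) r l -> cdiff (fun s => f (r s)) q (a * l%:C).
Proof.
move=> [f1 f2] dr; split.
  by rewrite ReM mulr0 subr0; exact: (der_comp f1 dr).
by rewrite ImM mulr0 add0r; exact: (der_comp f2 dr).
Qed.

(** Differentiability serves as continuity at 0: this extends to q = 0 the identities obtained by
    cancelling q. *)
Lemma cdiff_agree0 f g a b : cdiff f 0 a -> cdiff g 0 b ->
  (forall q, q != 0 -> f q = g q) -> f 0 = g 0.
Proof.
move=> [f1 f2] [g1 g2] fg.
have H (u v : R -> R) (l m : R) : is_derive (0 : R) (1 : R) u l ->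
    is_derive (0 : R) (1 : R) v m -> (forall q, q != 0 -> u q = v q) -> u 0 = v 0.
  move=> /der_continuous/continuous_withinNx uc /der_continuous/continuous_withinNx vc uv.
  have := @cvg_unique _ (@norm_hausdorff _ _) _ _ _ _ uc; apply.
  apply: cvg_trans vc; apply: near_eq_cvg.
  by near=> x; apply/esym/uv; near: x; exact: nbhs_dnbhs_neq.
by apply: complex_ext; [apply: (H _ _ _ _ f1 g1)|apply: (H _ _ _ _ f2 g2)] => q /fg ->.
Unshelve. all: end_near. Qed.

Definition cdecays f : Prop := forall A, exists M : R,
  forall q, (1 + q ^+ 2) ^+ A * normc (f q) <= M.

Lemma cdecays_Re f : cdecays f -> rdecays (fun q => complex.Re (f q)).
Proof.
move=> df A; have [M hM] := df A; exists M => q; apply: le_trans (hM q).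
by rewrite ler_wpM2l ?(ltW (weight_gt0 _ _))// normr_Re_le.
Qed.

Lemma cdecays_Im f : cdecays f -> rdecays (fun q => complex.Im (f q)).
Proof.
move=> df A; have [M hM] := df A; exists M => q; apply: le_trans (hM q).
by rewrite ler_wpM2l ?(ltW (weight_gt0 _ _))// normr_Im_le.
Qed.

Lemma rdecays_complex (u v : R -> R) : rdecays u -> rdecays v ->
  cdecays (fun q => u q +i* v q).
Proof.
move=> du dv A; have [M hM] := du A; have [N hN] := dv A; exists (M + N) => q.
apply: le_trans (lerD (hM q) (hN q)).
by rewrite -mulrDr ler_wpM2l ?(ltW (weight_gt0 _ _))// (le_trans (normc_le _)).
Qed.

Lemma cderivenS n f : cderiven n.+1 f = cderive (cderiven n f).
Proof. by []. Qed.

Lemma csmooth_cdiff f n q : csmooth f -> cdiff (cderiven n f) q (cderiven n.+1 f q).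
Proof. by move=> /(_ n q)[h1 h2]; split; rewrite cderivenS; exact: derivable_der. Qed.

Lemma cderiven_seq (F : nat -> R -> R[i]) n :
  (forall n q, cdiff (F n) q (F n.+1 q)) -> cderiven n (F 0%N) = F n.
Proof.
move=> dF; elim: n => // n IH; rewrite cderivenS IH.
by apply/funext => q; rewrite (cderiveE (dF n q)).
Qed.

Lemma csmooth_seq (F : nat -> R -> R[i]) :
  (forall n q, cdiff (F n) q (F n.+1 q)) -> csmooth (F 0%N).
Proof. by move=> dF n t; rewrite cderiven_seq//; have [] := dF n t. Qed.

Lemma schwartz_decays f n : is_schwartz f -> cdecays (cderiven n f).
Proof.
move=> [_ H] A; have [M hM] := H 0%N n; have [N hN] := H (A.*2)%N n.
exists (2 ^+ A * (M + N)) => q.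
have {}hM := hM _ (imageT (weighted 0 n f) q).
have {}hN := hN _ (imageT (weighted A.*2 n f) q).
have n0 := normc_ge0 (cderiven n f q).
apply: (@le_trans _ _ (2 ^+ A * (1 + `|q| ^+ A.*2) * normc (cderiven n f q))).
  rewrite ler_wpM2r// -mul2n exprM real_normK ?num_real//.
  have q20 := sqr_ge0 q; have [q1|q1] := leP (q ^+ 2) 1.
    rewrite (@le_trans _ _ (2 ^+ A))//; last by rewrite ler_peMr ?exprn_ge0// lerDl exprn_ge0.
    by rewrite lerXn2r ?nnegrE ?addr_ge0// -[2]/(1 + 1) lerD2l.
  rewrite (@le_trans _ _ (2 ^+ A * (q ^+ 2) ^+ A))//; last first.
    by rewrite ler_wpM2l ?exprn_ge0// lerDr.
  by rewrite -exprMn lerXn2r ?nnegrE//; lra.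
by rewrite -mulrA ler_wpM2l ?exprn_ge0// mulrDl lerD.
Qed.

Lemma decays_schwartz f : csmooth f -> (forall n, cdecays (cderiven n f)) ->
  is_schwartz f.
Proof.
move=> sf df; split=> // a b; have [M hM] := df b a; exists M => _ [q _ <-].
apply: le_trans (hM q); rewrite /weighted ler_wpM2r ?normc_ge0//.
have [q1|q1] := leP `|q| 1.
  by rewrite (@le_trans _ _ 1)// ?exprn_ile1// weight_ge1.
rewrite lerXn2r ?nnegrE ?addr_ge0 ?sqr_ge0// ler_wpDl//.
by rewrite -real_normK ?num_real// ler_eXnr// ltW.
Qed.

(** The derivatives may be guessed as a sequence, so iterated derivatives never have to be
    computed. *)
Lemma schwartz_seq (F : nat -> R -> R[i]) :
  (forall n q, cdiff (F n) q (F n.+1 q)) -> (forall n, cdecays (F n)) ->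
  is_schwartz (F 0%N).
Proof.
move=> dF decF; apply: decays_schwartz; first exact: csmooth_seq.
by move=> n; rewrite cderiven_seq.
Qed.

Lemma schwartz_cdiff f q : is_schwartz f -> cdiff f q (cderive f q).
Proof. by move=> [sf _]; exact: (csmooth_cdiff 0 q sf). Qed.

Lemma schwartz_hadamard f : is_schwartz f -> f 0 = 0 ->
  exists2 g, is_schwartz g & forall q, f q = q%:C * g q.
Proof.
move=> sf f0.
pose u n q := complex.Re (cderiven n f q); pose v n q := complex.Im (cderiven n f q).
have du n q : is_derive q (1 : R) (u n) (u n.+1 q) by have [] := csmooth_cdiff n q sf.1.
have dv n q : is_derive q (1 : R) (v n) (v n.+1 q) by have [] := csmooth_cdiff n q sf.1.
have u0 : u 0%N 0 = 0 by rewrite /u /= f0.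
have v0 : v 0%N 0 = 0 by rewrite /v /= f0.
have decu n : rdecays (u n) by apply: cdecays_Re; exact: schwartz_decays.
have decv n : rdecays (v n) by apply: cdecays_Im; exact: schwartz_decays.
exists (fun q => hadamard u 0 q +i* hadamard v 0 q).
  apply: (@schwartz_seq (fun n q => hadamard u n q +i* hadamard v n q)) => [n q|n].
    by split; exact: der_hadamard.
  by apply: rdecays_complex; exact: hadamard_decays.
move=> q; apply: complex_ext.
  by rewrite ReM /= mul0r subr0 -hadamardE.
by rewrite ImM /= mul0r addr0 -hadamardE.
Qed.

End ComplexCalculus.

(** * Chains of complex-valued Schwartz functions *)

Section Chains.
Context {R : realType}.
Implicit Types (q e : R) (f g : R -> R[i]) (A n h : nat).

Definition qchain (D : nat -> R -> R[i]) : Prop :=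
  forall n q, cdiff (D n) q (q%:C * D n.+1 q).

Lemma schwartz_cderive f : is_schwartz f -> is_schwartz (cderive f).
Proof.
move=> sf; apply: (@schwartz_seq _ (fun n => cderiven n.+1 f)) => [n q|n].
  exact: (csmooth_cdiff n.+1 q sf.1).
exact: schwartz_decays.
Qed.

Lemma cderive_reflect f q a : cdiff f (- q) a -> cdiff (fun s => f (- s)) q (- a).
Proof.
move=> df; apply: (cdiff_eq (cdiff_comp (r := fun s => - s) df (derN (is_derive_id q 1)))).
by rewrite rmorphN rmorph1 mulrN1.
Qed.

(** The derivative of g is odd, so it vanishes at 0 and can be divided by q within the Schwartz
    functions. *)
Lemma even_chain_step g : is_schwartz g -> (forall q, g (- q) = g q) ->
  exists g1, [/\ is_schwartz g1, forall q, g1 (- q) = g1 q &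
                 forall q, cdiff g q (q%:C * g1 q)].
Proof.
move=> sg ge.
have dN q : cderive g (- q) = - cderive g q.
  have := cderive_reflect (schwartz_cdiff (- q) sg).
  rewrite (_ : (fun s => g (- s)) = g); last by apply/funext.
  by move=> /cdiff_uniq/(_ (schwartz_cdiff q sg)) <-; rewrite opprK.
have d0 : cderive g 0 = 0.
  have := dN 0; rewrite oppr0 => /eqP; rewrite -addr_eq0 -mulr2n mulrn_eq0/=.
  by move/eqP.
have [g1 sg1 gE] := schwartz_hadamard (schwartz_cderive sg) d0.
exists g1; split=> // q; last by rewrite -gE; exact: schwartz_cdiff.
have [->|q0] := eqVneq q 0; first by rewrite oppr0.
have qC0 : q%:C != 0 by rewrite (inj_eq (@complexI R) q 0).
apply: (mulfI qC0); rewrite -gE -[LHS]opprK -mulNr -rmorphN -gE dN opprK//.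
Qed.

Lemma even_chain g : is_schwartz g -> (forall q, g (- q) = g q) ->
  exists D, [/\ D 0%N = g, qchain D, forall n q, D n (- q) = D n q &
                forall n, is_schwartz (D n)].
Proof.
move=> sg ge.
have /choice[nxt nxtP] : forall f, exists f1, is_schwartz f ->
    (forall q, f (- q) = f q) ->
    [/\ is_schwartz f1, forall q, f1 (- q) = f1 q &
        forall q, cdiff f q (q%:C * f1 q)].
  move=> f; have [[sf fe]|nf] := pselect (is_schwartz f /\ forall q, f (- q) = f q).
    by have [f1 H] := even_chain_step sf fe; exists f1.
  by exists f => sf fe; case: nf.
pose D n := iter n nxt g.
have H n : is_schwartz (D n) /\ forall q, D n (- q) = D n q.
  by elim: n => // n [sD De]; have [] := nxtP _ sD De.
exists D; split => // n.
- by move=> q; have [sD De] := H n; have [_ _] := nxtP _ sD De; exact.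
- by have [] := H n.
- by have [] := H n.
Qed.

(** The induction hypothesis is used twice: the shifted chain gives D 1 = q^(2h+1) g, the truncated
    one D 0 = q^(2h+1) e. Then D 0' = q D 1 reads (2h+1) e + q e' = q^2 g, first off 0 and then at
    0, whence e(0) = 0. Since e is even, two factors q split off. *)
Lemma odd_chain_factor h (D : nat -> R -> R[i]) :
    (forall j, (j <= h)%N -> is_schwartz (D j)) ->
    (forall j q, (j <= h)%N -> D j (- q) = - D j q) ->
    (forall j q, (j < h)%N -> cdiff (D j) q (q%:C * D j.+1 q)) ->
  exists g, [/\ is_schwartz g, forall q, g (- q) = g q &
                forall q, D 0%N q = q%:C ^+ h.*2.+1 * g q].
Proof.
have odd0 f : (forall q, f (- q) = - f q) -> f 0 = 0.
  move=> fo; have := fo 0; rewrite oppr0 => /eqP; rewrite -addr_eq0 -mulr2n.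
  by rewrite mulrn_eq0/= => /eqP.
have C0 (q : R) : q != 0 -> q%:C != 0 by rewrite (inj_eq (@complexI R) q 0).
elim: h D => [|h IH] D sD oD dD.
  have [g sg gE] := schwartz_hadamard (sD 0%N isT) (odd0 _ (fun q => oD 0%N q isT)).
  exists g; split => // q.
  have [->|q0] := eqVneq q 0; first by rewrite oppr0.
  by apply: (mulfI (C0 _ q0)); rewrite -gE -[LHS]opprK -mulNr -rmorphN -gE oD// opprK.
have [g [sg ge gE]] := IH (fun j => D j.+1) (fun j => sD j.+1)
  (fun j q => oD j.+1 q) (fun j q => dD j.+1 q).
have [e [se ee eE]] := IH D (fun j jh => sD j (leqW jh))
  (fun j q jh => oD j q (leqW jh)) (fun j q jh => dD j q (leqW jh)).
pose de := cderive e.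
have eq0 q : q != 0 -> h.*2.+1%:R * e q + q%:C * de q = q%:C ^+ 2 * g q.
  move=> q0.
  have := cdiffM (cdiffX h.*2.+1 q) (schwartz_cdiff q se).
  have -> : (fun s : R => s%:C ^+ h.*2.+1 * e s) = D 0%N by apply/funext.
  move=> /cdiff_uniq/(_ (dD 0%N q isT)); rewrite gE -/de /= => E.
  have qh0 : q%:C ^+ h.*2 != 0 by rewrite expf_neq0 ?C0.
  apply: (mulfI qh0); rewrite [RHS](_ : _ = q%:C * (q%:C ^+ h.*2.+1 * g q)).
    by rewrite -E exprS; ring.
  by rewrite (exprS _ h.*2); ring.
have e0 : e 0 = 0.
  have L : cdiff (fun q => h.*2.+1%:R * e q + q%:C * de q) 0
      (h.*2.+1%:R * cderive e 0 + (1%:C * de 0 + 0%:C * cderive de 0)).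
    apply: cdiffD; first by apply: cdiffZ; exact: schwartz_cdiff.
    apply: cdiffM; first exact: (cdiff_real (is_derive_id _ _)).
    exact: (schwartz_cdiff _ (schwartz_cderive se)).
  have Rr := cdiffM (cdiffX 2 0) (schwartz_cdiff 0 sg).
  have := cdiff_agree0 L Rr eq0.
  by rewrite !mul0r addr0 expr0n mul0r => /eqP; rewrite mulf_eq0 pnatr_eq0/= => /eqP.
have [e1 se1 e1E] := schwartz_hadamard se e0.
have e1o q : e1 (- q) = - e1 q.
  have [->|q0] := eqVneq q 0.
    (* off 0 the oddness is algebraic, at 0 it follows by continuity *)
    rewrite oppr0.
    have L : cdiff (fun s => e1 (- s)) 0 (- cderive e1 (- 0)).
      exact: (cderive_reflect (schwartz_cdiff _ se1)).
    have := cdiff_agree0 L (cdiffN (schwartz_cdiff 0 se1)).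
    rewrite oppr0; apply => s s0; apply: (mulfI (C0 _ s0)).
    by rewrite mulrN -e1E -[LHS]opprK -mulNr -rmorphN -e1E ee.
  apply: (mulfI (C0 _ q0)).
  by rewrite mulrN -e1E -[LHS]opprK -mulNr -rmorphN -e1E ee.
have [e2 se2 e2E] := schwartz_hadamard se1 (odd0 _ e1o).
exists e2; split => // q.
  have [->|q0] := eqVneq q 0; first by rewrite oppr0.
  by apply: (mulfI (C0 _ q0)); rewrite -e2E -[LHS]opprK -mulNr -rmorphN -e2E e1o opprK.
by rewrite eE e1E e2E doubleS (exprS _ h.*2.+2) (exprS _ h.*2.+1); ring.
Qed.

(** Off 0 the relation D_j' = q D_(j+1) determines the next member, and continuity settles q = 0.
    The last member starts no relation, so its regularity at 0 is a separate hypothesis. *)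
Lemma chain_unique h (D E : nat -> R -> R[i]) :
    (forall j q, (j < h)%N -> cdiff (D j) q (q%:C * D j.+1 q)) ->
    (forall j q, (j < h)%N -> cdiff (E j) q (q%:C * E j.+1 q)) ->
    (forall j, (j <= h)%N -> exists l, cdiff (D j) 0 l) ->
    (forall j, (j <= h)%N -> exists l, cdiff (E j) 0 l) ->
    (forall q, D 0%N q = E 0%N q) ->
  forall j q, (j <= h)%N -> D j q = E j q.
Proof.
move=> dD dE cD cE DE0; elim=> [q _|j IH q jh]; first exact: DE0.
have H s : s != 0 -> D j.+1 s = E j.+1 s.
  move=> s0; have sC0 : s%:C != 0 by rewrite (inj_eq (@complexI R) s 0).
  apply: (mulfI sC0); apply: cdiff_uniq (dD _ _ jh) _.
  have -> : D j = E j by apply/funext => x; exact: IH (ltnW jh).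
  exact: dE.
have [->|/H//] := eqVneq q 0.
have [l hl] := cD _ jh; have [k hk] := cE _ jh.
exact: (cdiff_agree0 hl hk).
Qed.

Definition cgauss (P : {poly R[i]}) n q : R[i] :=
  (iter n (@gop R[i]) P).[(q ^+ 2 / 2)%:C] * (expR (- (q ^+ 2 / 2)))%:C.

Lemma cgauss_ReIm (P Q : {poly R}) n q :
  cgauss (map_poly (real_complex R) P + 'i%C *: map_poly (real_complex R) Q) n q =
  rgauss P n q +i* rgauss Q n q.
Proof.
rewrite /cgauss; have -> : iter n (@gop R[i])
    (map_poly (real_complex R) P + 'i%C *: map_poly (real_complex R) Q) =
  map_poly (real_complex R) (iter n (@gop R) P) +
  'i%C *: map_poly (real_complex R) (iter n (@gop R) Q).
  elim: n => // n IH; rewrite !iterS IH /gop !rmorphB/= -!deriv_map.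
  by rewrite derivD derivZ scalerBr opprD addrACA.
rewrite /rgauss hornerD hornerZ !horner_map/=.
by apply: complex_ext; rewrite ?ReM ?ImM ?ReD ?ImD ?ReM ?ImM /=; ring.
Qed.

Lemma qchain_approx (D : nat -> R -> R[i]) m A e : qchain D ->
    (forall n q, D n (- q) = D n q) -> (forall n, cdecays (D n)) -> 0 < e ->
  exists P : {poly R[i]}, forall j q, (j <= m)%N ->
    (1 + q ^+ 2) ^+ A * normc (D j q - cgauss P j q) <= e.
Proof.
move=> Dc De Dd e0; have e20 : 0 < e / 2 by rewrite divr_gt0.
have [||n|P hP] := @rchain_approx R (fun n q => complex.Re (D n q)) m A _ _ _ _ e20.
- by move=> n q; have [h _] := Dc n q; apply: (der_eq h); rewrite ReM mul0r subr0.
- by move=> n q; rewrite De.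
- exact: cdecays_Re.
have [||n|Q hQ] := @rchain_approx R (fun n q => complex.Im (D n q)) m A _ _ _ _ e20.
- by move=> n q; have [_ h] := Dc n q; apply: (der_eq h); rewrite ImM mul0r addr0.
- by move=> n q; rewrite De.
- exact: cdecays_Im.
exists (map_poly (real_complex R) P + 'i%C *: map_poly (real_complex R) Q).
move=> j q jm; rewrite cgauss_ReIm [e]splitr.
apply: le_trans (lerD (hP _ q jm) (hQ _ q jm)).
rewrite -mulrDr ler_wpM2l ?(ltW (weight_gt0 _ _))//.
by rewrite (le_trans (normc_le _))// ReD ImD ReN ImN.
Qed.

Lemma poly_ReIm (P : {poly R[i]}) : exists P1 P2 : {poly R},
  P = map_poly (real_complex R) P1 + 'i%C *: map_poly (real_complex R) P2.
Proof.
exists (\poly_(i < size P) complex.Re P`_i), (\poly_(i < size P) complex.Im P`_i).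
by apply/polyP => i; rewrite coefD coefZ !coef_map; exact: complexE.
Qed.

Lemma cgauss_chain P : qchain (cgauss P).
Proof.
have [P1 [P2 ->]] := poly_ReIm P => n q; rewrite cgauss_ReIm.
have -> : cgauss (map_poly (real_complex R) P1 + 'i%C *: map_poly (real_complex R) P2) n =
    fun q => rgauss P1 n q +i* rgauss P2 n q by apply/funext => s; exact: cgauss_ReIm.
split; first by rewrite ReM mul0r subr0; exact: rgauss_chain.
by rewrite ImM mul0r addr0; exact: rgauss_chain.
Qed.

Lemma cgauss_decays P n : cdecays (cgauss P n).
Proof.
have [P1 [P2 ->]] := poly_ReIm P.
have -> : cgauss (map_poly (real_complex R) P1 + 'i%C *: map_poly (real_complex R) P2) n =
    fun q => rgauss P1 n q +i* rgauss P2 n q by apply/funext => s; exact: cgauss_ReIm.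
by apply: rdecays_complex; exact: rgauss_decays.
Qed.

(** The n-th iterate of the derivation q^-1 d/dq on the product of [a 0] and [D 0], when both are
    chains. *)
Definition leibniz (a D : nat -> R -> R[i]) n q : R[i] :=
  lsum n (fun i j => a j q * D i q).

Lemma leibniz_chain (a D : nat -> R -> R[i]) n q :
    (forall j, (j <= n)%N -> cdiff (a j) q (q%:C * a j.+1 q)) -> qchain D ->
  cdiff (leibniz a D n) q (q%:C * leibniz a D n.+1 q).
Proof.
move=> da dD; rewrite /leibniz lsumS /lsum mulrDr !mulr_sumr -big_split/=.
apply: cdiff_sum => j; apply: (cdiff_eq (cdiffZ _ (cdiffM (da j _) (dD _ _)))).
  by rewrite -ltnS.
by ring.
Qed.

End Chains.

(** * Seminorm estimates *)

Section MonomialCombinations.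
Context {R : realType}.
Implicit Types (q : R) (e : nat -> R -> R[i]) (A n a b : nat).

(* A triple [(c, r, j)] encodes the function [c * q ^+ r * e j q]. *)
Definition interp e (l : seq (R[i] * nat * nat)) q : R[i] :=
  \sum_(t <- l) t.1.1 * q%:C ^+ t.1.2 * e t.2 q.

(** Product rule for c q^r e_j with e_j' = q e_(j+1). The truncated exponent at r = 0 comes with the
    coefficient 0. *)
Definition interp_der (l : seq (R[i] * nat * nat)) : seq (R[i] * nat * nat) :=
  flatten [seq [:: (t.1.1 * t.1.2%:R, t.1.2.-1, t.2); (t.1.1, t.1.2.+1, t.2.+1)]
          | t <- l].

Lemma cdiff_interp e l q : qchain e -> cdiff (interp e l) q (interp e (interp_der l) q).
Proof.
move=> de; rewrite /interp /interp_der big_flatten big_map.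
apply: cdiff_sum => t.
apply: (cdiff_eq (cdiffM (cdiffZ t.1.1 (cdiffX t.1.2 q)) (de t.2 q))).
by rewrite big_cons big_seq1 /= exprS; ring.
Qed.

Lemma cderiven_interp e l b : qchain e ->
  cderiven b (interp e l) = interp e (iter b interp_der l).
Proof.
move=> de; rewrite -(@cderiven_seq _ (fun n => interp e (iter n interp_der l)))// => n q.
exact: cdiff_interp.
Qed.

Lemma abs_le_weight q : `|q| <= 1 + q ^+ 2.
Proof.
rewrite -[q ^+ 2]real_normK ?num_real//.
by have := sqr_ge0 (`|q| - 1); have := normr_ge0 q; nra.
Qed.

(** The constants depend on l and a alone, so the bound is uniform over a sequence of chains e. *)
Lemma interp_bound l a : exists C J, [/\ 0 <= C & exists A, forall e q (d : R),
  (forall j, (j <= J)%N -> (1 + q ^+ 2) ^+ A * normc (e j q) <= d) ->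
  (1 + q ^+ 2) ^+ a * normc (interp e l q) <= C * d].
Proof.
elim: l => [|[[c r] j0] l [C [J [C0 [A H]]]]].
  exists 0, 0%N; split=> //; exists 0%N => e q d _.
  by rewrite /interp big_nil normc0 mulr0 mul0r.
exists (normc c + C), (maxn J j0); split; first by rewrite addr_ge0// normc_ge0.
exists (maxn A (a + r)) => e q d hd.
have w0 n : 0 <= (1 + q ^+ 2) ^+ n := ltW (weight_gt0 n q).
have hC : (1 + q ^+ 2) ^+ a * normc (interp e l q) <= C * d.
  apply: H => j jJ; apply: le_trans (hd j _); last by rewrite leq_max jJ.
  by rewrite ler_wpM2r ?normc_ge0// weight_le// leq_maxl.
rewrite /interp big_cons/= mulrDl.
have hc := ler_wpM2l (normc_ge0 c) (hd j0 (leq_maxr _ _)).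
apply: le_trans (lerD hc hC).
rewrite -/(interp e l q).
apply: (@le_trans _ _ ((1 + q ^+ 2) ^+ a *
    (normc (c * q%:C ^+ r * e j0 q) + normc (interp e l q)))).
  by rewrite ler_wpM2l// le_normcD.
rewrite mulrDr lerD2r !normcM -rmorphXn normc_real normrX.
rewrite -[_ * _ * normc (e j0 q)]mulrA mulrCA ler_wpM2l ?normc_ge0//.
rewrite mulrA ler_wpM2r ?normc_ge0//.
rewrite (@le_trans _ _ ((1 + q ^+ 2) ^+ (a + r)))//; last by rewrite weight_le// leq_maxr.
by rewrite exprD ler_wpM2l// lerXn2r ?nnegrE ?addr_ge0 ?sqr_ge0// abs_le_weight.
Qed.

Lemma interp_schwartz e l : qchain e -> (forall j, cdecays (e j)) ->
  is_schwartz (interp e l).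
Proof.
move=> de decE; apply: (@schwartz_seq _ (fun n => interp e (iter n interp_der l))) => [n q|n].
  exact: cdiff_interp.
move: (iter _ _ _) => {n}l a.
have [C [J [C0 [A H]]]] := interp_bound l a.
have [d hd] : exists d : R, forall j q, (j <= J)%N ->
    (1 + q ^+ 2) ^+ A * normc (e j q) <= d.
  elim: J {H} => [|J [d hd]].
    by have [M hM] := decE 0%N A; exists M => -[|//] q _.
  have [M hM] := decE J.+1 A; exists (`|d| + `|M|) => j q.
  rewrite leq_eqVlt => /predU1P[->|jJ].
    by rewrite (le_trans (hM q))// (le_trans (ler_norm _))// lerDr.
  by rewrite (le_trans (hd j q jJ))// (le_trans (ler_norm _))// lerDl.
by exists (C * d) => q; apply: H => j jJ; exact: hd.
Qed.

(** The index n is at once the number of members controlled, the weight and the precision, so one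
    diagonal sequence works for every seminorm: past J and A the bound is C/(n+1). *)
Lemma seminorm_interp_small (e : nat -> nat -> R -> R[i]) l a b (eps : R) :
    (forall n, qchain (e n)) ->
    (forall n j q, (j <= n)%N ->
      (1 + q ^+ 2) ^+ n * normc (e n j q) <= n.+1%:R^-1) ->
    0 < eps ->
  \forall n \near \oo, seminorm a b (interp (e n) l) < eps.
Proof.
move=> de small eps0.
have [C [J [C0 [A H]]]] := interp_bound (iter b interp_der l) a.
have hlim : \forall n \near \oo, C / n.+1%:R < eps.
  have : C / n.+1%:R @[n --> \oo] --> C * 0.
    by apply: cvgM; [exact: cvg_cst|exact: cvg_harmonic].
  by rewrite mulr0 => /cvgrPdist_lt/(_ _ eps0); apply: filterS => n; 
    rewrite sub0r normrN ger0_norm// divr_ge0.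
near=> n.
have An : (A <= n)%N by near: n; exact: nbhs_infty_ge.
have Jn : (J <= n)%N by near: n; exact: nbhs_infty_ge.
apply: (@le_lt_trans _ _ (C / n.+1%:R)); last by near: n.
apply: ge_sup; first by exists (weighted a b (interp (e n) l) 0), 0.
move=> _ [q _ <-]; rewrite /weighted cderiven_interp//.
apply: (@le_trans _ _ ((1 + q ^+ 2) ^+ a * normc (interp (e n) (iter b interp_der l) q))).
  by rewrite ler_wpM2r ?normc_ge0// lerXn2r ?nnegrE ?addr_ge0 ?sqr_ge0// abs_le_weight.
apply: H => j jJ; apply: le_trans (small n j q (leq_trans jJ Jn)).
by rewrite ler_wpM2r ?normc_ge0// weight_le.
Unshelve. all: end_near. Qed.

End MonomialCombinations.

(** * The spinors s_k *)

Section FiniteDifferences.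
Context {K : comNzRingType}.
Implicit Types (a : nat -> K) (x z c : K).

Definition fdiff a (p : nat) : K := a p.+1 - a p.

Lemma bsumB h x z a b :
  bsum h x z (fun j => a j - b j) = bsum h x z a - bsum h x z b.
Proof. by rewrite /bsum /lsum -sumrB; apply: eq_bigr => j _; rewrite !mulrBr. Qed.

Lemma bsumZ h x z c a : bsum h x z (fun j => c * a j) = c * bsum h x z a.
Proof.
rewrite /bsum /lsum mulr_sumr; apply: eq_bigr => j _.
by rewrite [in RHS]mulrCA; congr (_ * _); rewrite mulrCA.
Qed.

(** With E the shift of sequences, [fdiff] is E - 1 and the identity is (x + z(E - 1))^h = ((x - z)
    + zE)^h. At z = -iy it produces the powers of x + iy in the spinors. *)
Lemma bsum_fdiff h x z a :
  bsum h x z (fun j => iter j fdiff a 0%N) = bsum h (x - z) z a.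
Proof.
elim: h a => [|h IH] a; first by rewrite !bsum0.
rewrite !bsumS IH (_ : (fun j => _) = fun j => iter j fdiff (fdiff a) 0%N); last first.
  by apply/funext => j; rewrite -iterSr.
by rewrite IH bsumB; ring.
Qed.

Lemma iter_fdiffZ n c a p : iter n fdiff (fun p => c * a p) p = c * iter n fdiff a p.
Proof. by elim: n p => // n IH p; rewrite !iterS /fdiff !IH mulrBr. Qed.

Lemma bsum_10 h a : bsum h 1 0 a = a 0%N.
Proof.
rewrite /bsum /lsum big_ord_recl/= bin0 expr1n expr0 !mul1r big1 ?addr0// => j _.
by rewrite /bump/= add1n expr0n/= mulr0 mul0r mulr0.
Qed.

End FiniteDifferences.

(** * Powers of q, bare and times the Gaussian *)

Section GaussMonomials.
Context {R : realType}.
Implicit Types (q x y : R) (m p j h k : nat).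

(* The [p]-th iterate of [q^-1 d/dq] on [q ^+ m], as long as no negative power of
   [q] shows up. *)
Definition mono m p q : R[i] :=
  if (2 * p <= m)%N then
    (double_fact m)%:R / (double_fact (m - 2 * p))%:R * q%:C ^+ (m - 2 * p)
  else 0.

Lemma double_fact_neq0 m : (double_fact m)%:R != 0 :> R[i].
Proof.
rewrite pnatr_eq0; suff : (double_fact m != 0)%N /\ (double_fact m.+1 != 0)%N by case.
by elim: m => // m [h1 h2]; split => //=; rewrite muln_eq0.
Qed.

Lemma mono0 m q : mono m 0 q = q%:C ^+ m.
Proof. by rewrite /mono muln0 subn0 divff ?mul1r// double_fact_neq0. Qed.

(** In the excluded case [mono m p] is a nonzero multiple of q, whose derivative is not divisible by
    q. For m = 2p it is a constant, and the chain continues with 0. *)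
Lemma mono_chain m p q : (2 * p).+1 != m -> cdiff (mono m p) q (q%:C * mono m p.+1 q).
Proof.
move=> pm; rewrite /mono mulnS; have [p2m|p2m] := leqP (2 + 2 * p) m.
  rewrite (leq_trans _ p2m) ?leq_addl//.
  have [n ->] : exists n, m = (2 + 2 * p + n)%N by exists (m - (2 + 2 * p))%N; rewrite subnKC.
  rewrite addKn (_ : 2 + 2 * p + n - 2 * p = n.+2)%N; last by lia.
  apply: (cdiff_eq (cdiffZ _ (cdiffX _ _))).
  rewrite [double_fact n.+2]/= natrM invfM /=.
  have n2 : n.+2%:R != 0 :> R[i] by rewrite pnatr_eq0.
  rewrite -!mulrA (mulrCA q%:C) (mulrCA q%:C) -exprS; congr (_ * _).
  by rewrite mulrCA [RHS]mulrC mulrA -mulrA mulKf// mulrC.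
rewrite mulr0; have [p2|_] := leqP (2 * p) m; last exact: cdiff_cst.
have -> : m = (2 * p)%N by move/eqP: pm; lia.
by rewrite subnn; apply: (cdiff_eq (cdiffZ _ (cdiffX _ _))); rewrite mul0r mulr0.
Qed.

Lemma mono_opp m p q : mono m p (- q) = (- 1) ^+ m * mono m p q.
Proof.
rewrite /mono; case: leqP => pm; last by rewrite mulr0.
have -> : (- 1) ^+ m = (- 1) ^+ (m - 2 * p) :> R[i].
  by rewrite -[in LHS](subnK pm) exprD exprM sqrrN !expr1n mulr1.
by rewrite rmorphN [in LHS]exprNn mulrCA.
Qed.

(* The [j]-th iterate of [q^-1 d/dq] on [q ^+ m * e^(-q^2/2)]: passing the Gaussian
   through the operator subtracts the identity from it. *)
Definition gmono m j q : R[i] :=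
  (expR (- (q ^+ 2 / 2)))%:C * iter j fdiff (fun p => mono m p q) 0%N.

Lemma gmono_opp m j q : gmono m j (- q) = (- 1) ^+ m * gmono m j q.
Proof.
rewrite /gmono sqrrN.
have -> : (fun p => mono m p (- q)) = fun p => (- 1) ^+ m * mono m p q.
  by apply/funext => p; exact: mono_opp.
by rewrite iter_fdiffZ mulrCA.
Qed.

Lemma gmono0 m q : gmono m 0 q = q%:C ^+ m * (expR (- (q ^+ 2 / 2)))%:C.
Proof. by rewrite /gmono/= mono0 mulrC. Qed.

Lemma fdiff_mono_chain m j p q : (forall i, (i <= p + j)%N -> (2 * i).+1 != m) ->
  cdiff (fun q => iter j fdiff (fun p => mono m p q) p) q
    (q%:C * iter j fdiff (fun p => mono m p q) p.+1).
Proof.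
elim: j p => [|j IH] p H; first by apply: mono_chain; apply: H; rewrite addn0.
rewrite iterS mulrBr; apply: cdiffB.
  by apply: IH => i hi; apply: H; rewrite addnS -addSn.
by apply: IH => i hi; apply: H; rewrite addnS leqW.
Qed.

Lemma cdiff_gauss q : cdiff (fun q : R => (expR (- (q ^+ 2 / 2)))%:C) q
  (- q%:C * (expR (- (q ^+ 2 / 2)))%:C).
Proof.
have dt : is_derive q (1 : R) (fun q => q ^+ 2 / 2) q.
  under eq_fun do rewrite mulrC.
  by apply: (der_eq (derZ _ (derX _ _))); rewrite /= expr1; field.
apply: (cdiff_eq (cdiff_real (der_expR (derN dt)))).
by rewrite rmorphM rmorphN mulrC.
Qed.

Lemma gmono_chain m j q : (forall i, (i <= j)%N -> (2 * i).+1 != m) ->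
  cdiff (gmono m j) q (q%:C * gmono m j.+1 q).
Proof.
move=> H; apply: (cdiff_eq (cdiffM (cdiff_gauss q) (@fdiff_mono_chain m j 0 q H))).
by rewrite /gmono iterS /fdiff; ring.
Qed.

Lemma interp_cat (e : nat -> R -> R[i]) l1 l2 q :
  interp e (l1 ++ l2) q = interp e l1 q + interp e l2 q.
Proof. by rewrite /interp big_cat. Qed.

Lemma interp_scale (e : nat -> R -> R[i]) c l q :
  interp e [seq (c * t.1.1, t.1.2, t.2) | t <- l] q = c * interp e l q.
Proof.
by rewrite /interp big_map mulr_sumr; apply: eq_bigr => t _; rewrite /= !mulrA.
Qed.

(** Only the Gaussian itself, member 0 of the chain of the polynomial 1, occurs; the Schwartz
    property then follows from [interp_schwartz]. *)
Lemma gmono_interp m j c : exists l,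
  (fun q => c * gmono m j q) = interp (cgauss (1 : {poly R[i]})) l.
Proof.
suff /(_ 0%N)[l hl] : forall p, exists l, forall q, (expR (- (q ^+ 2 / 2)))%:C *
    iter j fdiff (fun p => mono m p q) p = interp (cgauss (1 : {poly R[i]})) l q.
  exists [seq (c * t.1.1, t.1.2, t.2) | t <- l].
  by apply/funext => q; rewrite interp_scale -hl.
elim: j => [|j IH] p.
  have [pm|pm] := leqP (2 * p) m; last first.
    by exists [::] => q; rewrite /interp big_nil /= /mono leqNgt pm mulr0.
  exists [:: ((double_fact m)%:R / (double_fact (m - 2 * p))%:R, (m - 2 * p)%N, 0%N)] => q.
  by rewrite /interp big_seq1 /cgauss /= /mono pm -polyC1 hornerC mul1r mulrC.
have [l1 h1] := IH p.+1; have [l2 h2] := IH p.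
exists (l1 ++ [seq (- 1 * t.1.1, t.1.2, t.2) | t <- l2]) => q.
by rewrite interp_cat interp_scale -h1 -h2 iterS /fdiff mulrBr mulN1r.
Qed.

Lemma gmono_schwartz m j c : is_schwartz (fun q => c * gmono m j q).
Proof.
have [l ->] := gmono_interp m j c.
by apply: interp_schwartz; [exact: cgauss_chain|exact: cgauss_decays].
Qed.

End GaussMonomials.

(** * The spinor of a chain and the operator D_s *)

Section Spinors.
Context {R : realType}.
Implicit Types (q x y : R) (m p j h k : nat).

(** Formally (x - iyL)^h applied to [D 0], with L = q^-1 d/dq and D its chain of iterates. *)
Definition spin h (D : nat -> R -> R[i]) : spinor R := fun x y q =>
  bsum h x%:C (- ('i%C * y%:C)) (fun j => D j q).

Definition spin_weight h j : R[i] := 'C(h, j)%:R * (- 'i%C) ^+ j.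

Lemma i_neq0 : ('i%C : R[i]) != 0.
Proof. by rewrite eq_complex /= oner_eq0 andbF. Qed.

Lemma spin_weight_neq0 h j : (j <= h)%N -> spin_weight h j != 0.
Proof.
move=> jh; rewrite mulf_neq0 ?expf_neq0 ?oppr_eq0 ?i_neq0//.
by rewrite pnatr_eq0 -lt0n bin_gt0.
Qed.

(** The cancellation behind D_s u = 0: the y-derivative contributes i (j+1), the x-derivative h -
    j. *)
Lemma spin_weightS h j : (j < h)%N ->
  'i%C * j.+1%:R * spin_weight h j.+1 = (h - j)%:R * spin_weight h j.
Proof.
move=> jh; rewrite /spin_weight exprS.
have -> : (h - j)%:R * ('C(h, j)%:R * (- 'i%C) ^+ j) = (j.+1 * 'C(h, j.+1))%:R * (- 'i%C) ^+ j :> R[i].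
  by rewrite mul_bin_left natrM mulrA.
rewrite natrM; have -> : 'i%C * j.+1%:R * ('C(h, j.+1)%:R * (- 'i%C * (- 'i%C) ^+ j)) =
  - ('i%C ^+ 2) * (j.+1%:R * 'C(h, j.+1)%:R * (- 'i%C) ^+ j) :> R[i] by ring.
by rewrite sqr_i opprK mul1r.
Qed.

Lemma spin_sum h D x y q : spin h D x y q =
  \sum_(j < h.+1) (x ^+ (h - j) * y ^+ j)%:C * (spin_weight h j * D j q).
Proof.
rewrite /spin /bsum /lsum; apply: eq_bigr => j _.
by rewrite rmorphM !rmorphXn /= -mulNr exprMn /spin_weight; ring.
Qed.

(** By [bsum_fdiff]; the restriction p <= k matches the vanishing of [mono (2 * k) p] for p > k. *)
Lemma s_evenE h k : s_even h k = spin h (@gmono R (2 * k)).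
Proof.
apply/funext => x; apply/funext => y; apply/funext => q.
rewrite /s_even /spin /gmono bsumZ bsum_fdiff opprK; congr (_ * _).
rewrite /bsum /lsum big_mkcond; apply: eq_bigr => p _; rewrite /mono leq_mul2l/=.
case: ifP => _; last by rewrite !mulr0.
by rewrite [in RHS]exprNn; ring.
Qed.

Lemma s_oddE h k : (h <= k)%N -> s_odd h k = spin h (@gmono R (2 * k + 1)).
Proof.
move=> hk; apply/funext => x; apply/funext => y; apply/funext => q.
rewrite /s_odd /spin /gmono bsumZ bsum_fdiff opprK; congr (_ * _).
rewrite /bsum /lsum; apply: eq_bigr => p _; rewrite /mono ifT; last first.
  by have := ltn_ord p; lia.
by rewrite [in RHS]exprNn; ring.
Qed.

(** The y-derivative loses the term j = 0 and the x-derivative the term j = h; after a shift both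
    run over the monomials x^(h-1-j) y^j, pairing [F j.+1] with [dF j]. *)
Lemma Ds_sum h (F dF : nat -> R -> R[i]) x y q :
    (forall j q, (j <= h)%N -> cdiff (F j) q (dF j q)) ->
  Ds (fun x y q => \sum_(j < h.+1) (x ^+ (h - j) * y ^+ j)%:C * F j q) x y q =
  \sum_(j < h) (x ^+ (h - j.+1) * y ^+ j)%:C *
    ('i%C * q%:C * (j.+1%:R * F j.+1 q) - (h - j)%:R * dF j q).
Proof.
move=> dFE; rewrite /Ds.
have dy : d_y (fun x y q => \sum_(j < h.+1) (x ^+ (h - j) * y ^+ j)%:C * F j q) x y q =
    \sum_(j < h.+1) (x ^+ (h - j) * (j%:R * y ^+ j.-1))%:C * F j q.
  apply: cderiveE; apply: cdiff_sum => j.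
  apply: (cdiff_eq (cdiffM (cdiff_real (derZ _ (derX _ _))) (cdiff_cst (F j q) y))).
  by rewrite mulr0 addr0.
have dq : d_q (fun x y q => \sum_(j < h.+1) (x ^+ (h - j) * y ^+ j)%:C * F j q) =
    fun x y q => \sum_(j < h.+1) (x ^+ (h - j) * y ^+ j)%:C * dF j q.
  apply/funext => x'; apply/funext => y'; apply/funext => q'.
  apply: cderiveE; apply: cdiff_sum => j.
  by apply: cdiffZ; apply: dFE; rewrite -ltnS.
have dx : d_x (fun x y q => \sum_(j < h.+1) (x ^+ (h - j) * y ^+ j)%:C * dF j q) x y q =
    \sum_(j < h.+1) ((h - j)%:R * x ^+ (h - j).-1 * y ^+ j)%:C * dF j q.
  apply: cderiveE; apply: cdiff_sum => j.
  have dxy := derM (derX (h - j) x) (is_derive_cst (y ^+ j) x (1 : R)).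
  apply: (cdiff_eq (cdiffM (cdiff_real dxy) (cdiff_cst (dF j q) x))).
  by rewrite !mulr0 !addr0.
rewrite dq dx dy big_ord_recl /= mul0r mulr0 rmorph0 mul0r add0r.
rewrite [X in _ - X]big_ord_recr /= subnn mul0r mul0r rmorph0 mul0r addr0.
rewrite mulr_sumr -sumrB; apply: eq_bigr => j _; rewrite /bump /= add1n -subnS.
by rewrite mulrBr !rmorphM !rmorphXn !rmorph_nat /=; ring.
Qed.

Lemma poly_vanish_real (P : {poly R[i]}) : (forall x : R, P.[x%:C] = 0) -> P = 0.
Proof.
move=> H; apply/eqP/negPn/negP => P0.
have := @max_poly_roots _ P (mkseq (fun n => n%:R) (size P)) P0.
rewrite size_mkseq ltnn => h; suff : false by []; apply: h.
  by apply/allP => _ /mapP[n _ ->]; rewrite rootE -(rmorph_nat (real_complex R)) H.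
by rewrite map_inj_uniq ?iota_uniq// => n1 n2 /eqP; rewrite eqr_nat => /eqP.
Qed.

(** A homogeneous polynomial taken at x = 1, whence the powers of 1, is a polynomial in y vanishing
    on the real line. *)
Lemma homogeneous_vanish n (c : nat -> R[i]) (d : nat -> nat) :
  (forall y : R, \sum_(j < n) (1 ^+ (d j) * y ^+ j)%:C * c j = 0) ->
  forall j, (j < n)%N -> c j = 0.
Proof.
move=> H j jn; have : \poly_(j < n) c j = 0.
  apply: poly_vanish_real => x; rewrite horner_poly -[RHS](H x).
  by apply: eq_bigr => i _; rewrite expr1n mul1r rmorphXn mulrC.
by move/(congr1 (fun p : {poly R[i]} => p`_j)); rewrite coef_poly jn coef0.
Qed.

End Spinors.

(** * Symplectic monogenics *)

Section Monogenics.
Context {R : realType}.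
Implicit Types (q x y : R) (m p j h k n : nat).

Lemma schwartzZ (c : R[i]) (f : R -> R[i]) : is_schwartz f ->
  is_schwartz (fun q => c * f q).
Proof.
move=> sf; apply: (@schwartz_seq _ (fun n q => c * cderiven n f q)) => [n q|n A].
  by apply: cdiffZ; exact: (csmooth_cdiff n q sf.1).
have [M hM] := schwartz_decays n sf A; exists (normc c * M) => q.
by rewrite normcM mulrCA ler_wpM2l ?normc_ge0.
Qed.

Lemma spinor_of_spin h (f : spinor_coef R h) (D : nat -> R -> R[i]) :
  (forall (j : 'I_h.+1) q, f j q = spin_weight h j * D j q) ->
  spinor_of f = spin h D.
Proof.
move=> fD; apply/funext => x; apply/funext => y; apply/funext => q.
by rewrite spin_sum; apply: eq_bigr => j _; rewrite fD.
Qed.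

Lemma monogenic_spin h (D : nat -> R -> R[i]) :
    (forall j, (j <= h)%N -> is_schwartz (D j)) ->
    (forall j q, (j < h)%N -> cdiff (D j) q (q%:C * D j.+1 q)) ->
  monogenic h (spin h D).
Proof.
move=> sD dD; split.
  exists (fun j : 'I_h.+1 => Schwartz (schwartzZ (spin_weight h j) (sD j (ltn_ord j)))) => //.
  exact: spinor_of_spin.
move=> x y q.
have -> : spin h D = fun x y q =>
    \sum_(j < h.+1) (x ^+ (h - j) * y ^+ j)%:C * (spin_weight h j * D j q).
  by apply/funext => x'; apply/funext => y'; apply/funext => q'; exact: spin_sum.
rewrite (@Ds_sum _ h (fun j q => spin_weight h j * D j q)
    (fun j q => spin_weight h j * cderive (D j) q)); last first.
  by move=> j s jh; apply: cdiffZ; apply: schwartz_cdiff; exact: sD.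
rewrite big1// => j _; rewrite (cderiveE (dD j q (ltn_ord j))).
rewrite [_ - _](_ : _ = ('i%C * j.+1%:R * spin_weight h j.+1 -
    (h - j)%:R * spin_weight h j) * (q%:C * D j.+1 q)); last by ring.
by rewrite spin_weightS// subrr mul0r mulr0.
Qed.

(** Comparing coefficients in D_s u = 0 gives i q (j+1) F_(j+1) = (h-j) F_j', and division by
    [spin_weight] turns this into the chain relation. The scalar s, taken as 1 or -1, treats both
    parities. *)
Lemma monogenic_chain h (u : spinor R) : monogenic h u ->
  exists (f : spinor_coef R h) (D : nat -> R -> R[i]),
    [/\ u = spinor_of f,
        forall (j : 'I_h.+1) q, f j q = spin_weight h j * D j q,
        forall j, (j <= h)%N -> is_schwartz (D j),
        forall j q, (j < h)%N -> cdiff (D j) q (q%:C * D j.+1 q) &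
        forall s : R[i], (forall x y q, u x y (- q) = s * u x y q) ->
          forall j q, (j <= h)%N -> D j (- q) = s * D j q].
Proof.
move=> [[f _ <-] Du].
(* Beyond h, [inord] falls back on the index 0; only j <= h matters below. *)
pose F j : R -> R[i] := f (inord j).
have sF j : is_schwartz (F j) := schwartzP _.
pose D j q := (spin_weight h j)^-1 * F j q.
have FD j q : (j <= h)%N -> F j q = spin_weight h j * D j q.
  by move=> jh; rewrite /D mulrA divff ?mul1r// spin_weight_neq0.
have uF : spinor_of f = fun x y q => \sum_(j < h.+1) (x ^+ (h - j) * y ^+ j)%:C * F j q.
  apply/funext => x; apply/funext => y; apply/funext => q.
  by apply: eq_bigr => j _; rewrite /F inord_val.
exists f, D; split => //.
- by move=> j q; rewrite -FD ?/F ?inord_val// -ltnS.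
- by move=> j _; exact: schwartzZ.
- move=> j q jh.
  have E : 'i%C * q%:C * (j.+1%:R * F j.+1 q) - (h - j)%:R * cderive (F j) q = 0.
    apply: (@homogeneous_vanish _ h (fun j => 'i%C * q%:C * (j.+1%:R * F j.+1 q) -
      (h - j)%:R * cderive (F j) q) (fun j => (h - j.+1)%N)) jh => y.
    rewrite -(@Ds_sum _ h F (fun j => cderive (F j))) -?uF//.
    by move=> i s _; exact: schwartz_cdiff.
  have hj0 : (h - j)%:R != 0 :> R[i] by rewrite pnatr_eq0 subn_eq0 -ltnNge.
  apply: (cdiff_eq (cdiffZ _ (schwartz_cdiff q (sF j)))).
  have w0 : spin_weight h j != 0 :> R[i] := spin_weight_neq0 (ltnW jh).
  apply: (mulfI w0); apply: (mulfI hj0); rewrite mulVKf//.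
  move/eqP: E; rewrite subr_eq0 => /eqP <-.
  rewrite FD// [RHS]mulrA -spin_weightS//; ring.
- move=> s us j q jh.
  have E : F j (- q) - s * F j q = 0.
    apply: (@homogeneous_vanish _ h.+1 (fun j => F j (- q) - s * F j q)
      (fun j => (h - j)%N)) jh => y.
    have := us 1 y q; rewrite uF => uE.
    rewrite -[RHS](subrr (\sum_(j < h.+1) (1 ^+ (h - j) * y ^+ j)%:C * F j (- q))).
    rewrite [X in _ - X]uE mulr_sumr -sumrB; apply: eq_bigr => i _.
    by rewrite mulrBr [in RHS]mulrCA.
  by rewrite /D mulrCA; congr (_ * _); move/eqP: E; rewrite subr_eq0 => /eqP.
Qed.

Lemma eq_spin h (D E : nat -> R -> R[i]) :
  (forall j q, (j <= h)%N -> D j q = E j q) -> spin h D = spin h E.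
Proof.
move=> DE; apply/funext => x; apply/funext => y; apply/funext => q.
by rewrite !spin_sum; apply: eq_bigr => j _; rewrite DE// -ltnS.
Qed.

Lemma spin_lincomb h N (c : nat -> R[i]) (E : nat -> nat -> R -> R[i]) x y q :
  spin h (fun j q => \sum_(k < N) c k * E k j q) x y q =
  \sum_(k < N) c k * spin h (E k) x y q.
Proof.
under [RHS]eq_bigr do rewrite spin_sum mulr_sumr.
rewrite spin_sum exchange_big/=; apply: eq_bigr => j _.
by rewrite !mulr_sumr; apply: eq_bigr => k _; ring.
Qed.

Lemma spin_gmono_opp h m x y q :
  spin h (gmono m) x y (- q) = (- 1) ^+ m * spin h (@gmono R m) x y q.
Proof.
by rewrite !spin_sum mulr_sumr; apply: eq_bigr => j _; rewrite gmono_opp; ring.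
Qed.

(** At x = 1, y = 0 only the coefficient of x^h survives, and it is q^(d k) times the Gaussian;
    distinct powers of q are independent. *)
Lemma lin_indep_gmono h (I : pred nat) (d : nat -> nat) (s : nat -> spinor R) :
    injective d -> (forall k, I k -> s k = spin h (gmono (d k))) ->
  lin_indep I s.
Proof.
move=> dI sE n c lc k kn Ik.
have : \sum_(i < n | I i) c i *: 'X^(d i) = 0.
  apply: poly_vanish_real => q.
  have e0 : (expR (- (q ^+ 2 / 2)))%:C != 0.
    by rewrite (inj_eq (@complexI R) _ 0) gt_eqF ?expR_gt0.
  apply: (mulIf e0); rewrite mul0r -[RHS](lc 1 0 q) /lincomb horner_sum mulr_suml.
  apply: eq_bigr => i Ii; rewrite sE// /spin mulr0 oppr0 bsum_10 gmono0.
  by rewrite hornerZ hornerXn mulrA.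
move/(congr1 (fun p : {poly R[i]} => p`_(d k))).
rewrite coef_sum coef0 (bigD1 (Ordinal kn))//= coefZ coefXn eqxx mulr1 big1 ?addr0//.
move=> i /andP[_ ik]; rewrite coefZ coefXn (inj_eq dI) eq_sym.
by rewrite (_ : (_ == _) = false) ?mulr0//; apply: contraNF ik => /eqP ik; apply/eqP/val_inj.
Qed.

Definition mono_coef m p : R[i] :=
  if (2 * p <= m)%N then (double_fact m)%:R / (double_fact (m - 2 * p))%:R else 0.

Lemma monoE m p q : mono m p q = mono_coef m p * q%:C ^+ (m - 2 * p).
Proof. by rewrite /mono /mono_coef; case: ifP; rewrite ?mul0r. Qed.

(** The list does not mention the chain: by linearity, the error between two chains is interpreted
    by the same list. *)
Definition leibniz_terms (w : R[i]) m j : seq (R[i] * nat * nat) :=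
  [seq (w * 'C(j, i)%:R * mono_coef m i, (m - 2 * i)%N, (j - i)%N) | i <- iota 0 j.+1].

Lemma leibniz_interp w m j (e : nat -> R -> R[i]) q :
  w * leibniz (mono m) e j q = interp e (leibniz_terms w m j) q.
Proof.
rewrite /leibniz /lsum /interp /leibniz_terms big_map mulr_sumr.
rewrite -[iota 0 j.+1]/(index_iota 0 j.+1) big_mkord; apply: eq_bigr => i _.
by rewrite /= monoE; ring.
Qed.

Lemma interpB (e1 e2 : nat -> R -> R[i]) l q :
  interp e1 l q - interp e2 l q = interp (fun j q => e1 j q - e2 j q) l q.
Proof. by rewrite /interp -sumrB; apply: eq_bigr => t _; rewrite mulrBr. Qed.

Lemma ptws_cvg (I : Type) (T : topologicalType) (F : nat -> I -> T) (f : I -> T) :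
  (forall i, F n i @[n --> \oo] --> f i) ->
  F n @[n --> \oo] --> (f : {ptws I -> T}).
Proof.
move=> Ff; apply/cvg_sup => i; apply/cvg_image.
  by rewrite eqEsubset; split=> v // _; exists (fun=> v).
move=> W /= /Ff FW; exists (@^~ i @^-1` W) => //.
rewrite eqEsubset; split => [_ [g Wg <-]|j Wj]; first exact: Wg.
exact: (@ex_intro2 _ _ _ (fun=> j) Wj erefl).
Qed.

Lemma closure_seq (T : topologicalType) (B : set T) (F : nat -> T) (f : T) :
  (forall n, B (F n)) -> F n @[n --> \oo] --> f -> closure B f.
Proof.
by move=> BF Ff U /Ff [N _ NU]; exists (F N); split; [exact: BF|exact: (NU N (leqnn N))].
Qed.

Lemma schwartz_cvg (F : nat -> schwartz R) (f : schwartz R) :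
  (forall a b (e : R), 0 < e ->
    \forall n \near \oo, seminorm a b (fun q => f q - F n q) < e) ->
  F n @[n --> \oo] --> f.
Proof.
move=> H; apply/cvg_entourageP => A [[N e] /= e0 sA].
have : \forall n \near \oo, forall ab : 'I_N.+1 * 'I_N.+1,
    seminorm ab.1 ab.2 (fun q => f q - F n q) < e.
  by apply: filter_forall => -[a b]; exact: H.
apply: filterS => n h; apply: sA => a b aN bN /=.
by have := h (Ordinal (n := N.+1) (m := a) aN, Ordinal (n := N.+1) (m := b) bN).
Qed.

End Monogenics.

(** * Density of the spans *)

Section Density.
Context {R : realType}.
Implicit Types (q x y : R) (m p j h k n : nat).

Lemma leibniz_diff m (e : nat -> R -> R[i]) j q : qchain e ->
  exists l, cdiff (leibniz (mono m) e j) q l.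
Proof.
move=> de; have -> : leibniz (mono m) e j = interp e (@leibniz_terms R 1 m j).
  by apply/funext => s; rewrite -leibniz_interp mul1r.
by eexists; exact: cdiff_interp.
Qed.

(** Both sides are chains up to h starting from q^m P(q^2/2) e^(-q^2/2), so uniqueness applies; 2^k
    comes from t = q^2/2. *)
Lemma leibniz_gauss m h (P : {poly R[i]}) :
    (forall i k, (i < h)%N -> (2 * i).+1 != (m + 2 * k)%N) ->
  forall j q, (j <= h)%N -> leibniz (mono m) (cgauss P) j q =
    \sum_(k < size P) P`_k / 2 ^+ k * gmono (m + 2 * k) j q.
Proof.
move=> Hm; apply: chain_unique => [j q jh|j q jh|j jh|j jh|q].
- apply: leibniz_chain; last exact: cgauss_chain.
  move=> i ij; apply: mono_chain.
  by have := Hm i 0%N (leq_ltn_trans ij jh); rewrite muln0 addn0.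
- rewrite mulr_sumr; apply: cdiff_sum => k.
  rewrite mulrCA; apply: cdiffZ; apply: gmono_chain => i ij.
  exact: Hm (leq_ltn_trans ij jh).
- by apply: leibniz_diff; exact: cgauss_chain.
- eexists; apply: cdiff_sum => k; apply: schwartz_cdiff; exact: gmono_schwartz.
- rewrite /leibniz /lsum big_ord1 bin0 mul1r mono0 subnn /cgauss/=.
  rewrite horner_coef mulr_suml mulr_sumr; apply: eq_bigr => k _.
  have -> : (q ^+ 2 / 2)%:C ^+ k = q%:C ^+ (2 * k) / 2 ^+ k.
    by rewrite rmorphM fmorphV rmorphXn rmorph_nat exprMn exprVn exprM.
  by rewrite gmono0 exprD; ring.
Qed.

(* [m = 0] is the even case, [m = 2h+1] the odd one. *)
Lemma monogenic_approx h m (f : spinor_coef R h) (D : nat -> R -> R[i]) (g : R -> R[i]) :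
    (forall i k, (i < h)%N -> (2 * i).+1 != (m + 2 * k)%N) ->
    (forall (j : 'I_h.+1) q, f j q = spin_weight h j * D j q) ->
    (forall j, (j <= h)%N -> is_schwartz (D j)) ->
    (forall j q, (j < h)%N -> cdiff (D j) q (q%:C * D j.+1 q)) ->
    is_schwartz g -> (forall q, g (- q) = g q) ->
    (forall q, D 0%N q = q%:C ^+ m * g q) ->
  closure [set f' : spinor_coef R h | exists N (c : nat -> R[i]), spinor_of f' =
    fun x y q => \sum_(k < N) c k * spin h (gmono (m + 2 * k)) x y q] f.
Proof.
move=> Hm fD sD dD sg ge D0.
have [G [G0 dG Ge sG]] := even_chain sg ge.
have DG j q : (j <= h)%N -> D j q = leibniz (mono m) G j q.
  move: j q; apply: chain_unique => [//|j q jh|j jh|j jh|q].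
  - apply: leibniz_chain => // i ij; apply: mono_chain.
    by have := Hm i 0%N (leq_ltn_trans ij jh); rewrite muln0 addn0.
  - by eexists; apply: schwartz_cdiff; exact: sD.
  - exact: leibniz_diff.
  - by rewrite D0 /leibniz /lsum big_ord1 bin0 mul1r mono0 subnn G0.
have /choice[P hP] : forall n, exists P : {poly R[i]}, forall j q, (j <= n)%N ->
    (1 + q ^+ 2) ^+ n * normc (G j q - cgauss P j q) <= n.+1%:R^-1.
  move=> n; apply: qchain_approx => // i.
  exact: (schwartz_decays 0 (sG i)).
pose l (j : nat) := @leibniz_terms R (spin_weight h j) m j.
(* Only the chain of g is replaced by a Gaussian one; the factor q^m is kept, so the approximants
   stay in the span. *)
pose F n : spinor_coef R h := fun j : 'I_h.+1 => Schwartz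
  (interp_schwartz (l j) (cgauss_chain (P n)) (cgauss_decays (P n))).
apply: (@closure_seq _ _ F) => [n|].
  exists (size (P n)), (fun k => (P n)`_k / 2 ^+ k).
  rewrite (@spinor_of_spin _ _ _ (leibniz (mono m) (cgauss (P n)))); last first.
    by move=> j q; rewrite leibniz_interp.
  rewrite (eq_spin (leibniz_gauss (P n) Hm)).
  apply/funext => x; apply/funext => y; apply/funext => q.
  exact: (spin_lincomb h (size (P n)) (fun k => (P n)`_k / 2 ^+ k)
    (fun k => gmono (m + 2 * k))).
apply: ptws_cvg => j; apply: schwartz_cvg => a b e e0.
have : \forall n \near \oo,
    seminorm a b (interp (fun j q => G j q - cgauss (P n) j q) (l j)) < e.
  apply: (@seminorm_interp_small R (fun n j q => G j q - cgauss (P n) j q)) => // n i q.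
  by rewrite mulrBr; apply: cdiffB; [exact: dG|exact: cgauss_chain].
apply: filterS => n; congr (seminorm a b _ < e); apply/funext => q.
by rewrite -interpB /F /= fD DG ?leibniz_interp// -ltnS.
Qed.

End Density.

Theorem proposition6p1 (R : realType) (h : nat) :
  topological_basis h (@monogenic_odd R h) (fun k => (h <= k)%N) (@s_odd R h) /\
  topological_basis h (@monogenic_even R h) xpredT (@s_even R h).
Proof.
have sgmono m j : is_schwartz (@gmono R m j).
  have -> : gmono m j = fun q => 1 * @gmono R m j q by apply/funext => q; rewrite mul1r.
  exact: gmono_schwartz.
split; split.
- move=> k hk; rewrite s_oddE//; split=> [|x y q].
    apply: monogenic_spin => // j q jh; apply: gmono_chain => i ij.
    by apply/eqP; lia.
  by rewrite spin_gmono_opp addn1 exprS exprM sqrrN !expr1n mulr1 mulN1r.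
- apply: (@lin_indep_gmono R h _ (fun k => 2 * k + 1)%N); first by move=> i j; lia.
  by move=> k; exact: s_oddE.
- move=> u [/monogenic_chain[f [D [-> fD sD dD Dpar]]] uo].
  have Do j q : (j <= h)%N -> D j (- q) = - D j q.
    move=> jh; rewrite (Dpar (- 1)) ?mulN1r// => x y s.
    by rewrite uo mulN1r.
  have [g [sg ge gE]] := odd_chain_factor sD Do dD.
  exists f => //; apply: closure_subset (monogenic_approx _ fD sD dD sg ge gE).
    (* The exponent 2h+1+2k belongs to the spinor of index h + k, hence the shift by h; the indices
       below h are filtered out of the span. *)
    move=> f' [N [c cE]]; exists (h + N)%N, (fun k => c (k - h)%N) => /=.
    rewrite cE; apply/funext => x; apply/funext => y; apply/funext => q.
    rewrite /lincomb [RHS]big_mkcond big_split_ord /= [X in _ = X + _]big1 ?add0r => [|i _].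
      apply: eq_bigr => i _; rewrite leq_addr addKn s_oddE ?leq_addr//.
      by congr (_ * spin h (gmono _) x y q); lia.
    by rewrite leqNgt ltn_ord.
  by move=> i k ih; apply/eqP; lia.
- move=> k _; rewrite s_evenE; split=> [|x y q].
    apply: monogenic_spin => // j q jh; apply: gmono_chain => i ij.
    by apply/eqP; lia.
  by rewrite spin_gmono_opp exprM sqrrN !expr1n mul1r.
- apply: (@lin_indep_gmono R h _ (fun k => 2 * k)%N); first by move=> i j; lia.
  by move=> k _; exact: s_evenE.
- move=> u [/monogenic_chain[f [D [-> fD sD dD Dpar]]] ue].
  have De q : D 0%N (- q) = D 0%N q.
    by rewrite (Dpar 1) ?mul1r// => x y s; rewrite ue mul1r.
  have gE q : D 0%N q = q%:C ^+ 0 * D 0%N q by rewrite mul1r.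
  exists f => //; apply: closure_subset (monogenic_approx _ fD sD dD (sD 0%N isT) De gE).
    move=> f' [N [c cE]]; exists N, c => /=.
    rewrite cE; apply/funext => x; apply/funext => y; apply/funext => q.
    by apply: eq_bigr => k _; rewrite s_evenE.
  by move=> i k ih; apply/eqP; lia.
Qed.
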